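(* Let $\alpha\in(-1,1)$, $\beta=(1-\alpha)/2$, and assume $1/\beta$ is not an integer. Let $\kappa$ be the smallest integer strictly greater than $1/\beta$ and $c(\beta)=(\kappa-1/\beta+1)/2\in(1/2,1)$. Let $\gamma=1/(1+\beta v_x/v_y)$ and $\xi=(1-\gamma)(v_y/\gamma)^{1/2}$. Let $\pi$ be a prior such that $m_\pi$ is positive, twice continuously differentiable, and all expectations involved are finite (with differentiation under integrals justified). If $$\Delta_u\left\{E_{Z_1}\!\left[m_\pi^{\kappa}(tZ_1+u,\,v_x\gamma)\right]\right\}^{c(\beta)/\kappa}\le 0\quad\text{for all }u\in\mathbb{R}^d,\ 0\le t\le\xi,$$ where $Z_1\sim N_d(0,I)$, then $R_\alpha(\mu;\hat p_\pi)\le R_\alpha(\mu;\hat p_U)$ for all $\mu\in\mathbb{R}^d$.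
   Context: Let $d\ge 3$, $v_x,v_y>0$ known; $X\sim N_d(\mu,v_xI)$, $Y\sim N_d(\mu,v_yI)$ independent. $\phi(\cdot,\sigma^2)$ is the $N_d(0,\sigma^2I)$ density; $m_\pi(x,v)=\int\phi(x-\mu,v)\pi(\mu)d\mu$. The Bayes predictive density is $\hat p_\pi(y\mid x;\alpha)=\frac{m_\pi^{1/\beta}(\gamma x+(1-\gamma)y,v_x\gamma)}{E_{Z_1}[m_\pi^{1/\beta}(x+\xi Z_1,v_x\gamma)]}\phi(y-x,v_y/\gamma)$, and $\hat p_U(y\mid x;\alpha)=\phi(y-x,v_y+\beta v_x)$ (the case $\pi\equiv1$). The $\alpha$-divergence loss is $D_\alpha=\int f_\alpha\!\left(\hat p(y\mid x)/\phi(y-\mu,v_y)\right)\phi(y-\mu,v_y)\,dy$ with $f_\alpha(z)=\frac{4}{1-\alpha^2}(1-z^{(1+\alpha)/2})$, and the risk is $R_\alpha(\mu;\hat p)=\int D_\alpha\,\phi(x-\mu,v_x)\,dx$. *)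

(* Defs.v *)
From mathcomp Require Import all_boot all_order all_algebra.
From mathcomp Require Import all_classical all_reals all_analysis.
Import Order.TTheory GRing.Theory Num.Def Num.Theory.
Import numFieldNormedType.Exports.
Set Implicit Arguments. Unset Strict Implicit. Unset Printing Implicit Defensive.
Local Open Scope classical_set_scope.
Local Open Scope ring_scope.

Section Defs.
Variable R : realType.

(* Lebesgue integral over R^d, computed as the d-fold iterated one-dimensional
   Lebesgue integral (by Tonelli/Fubini this is the Lebesgue integral on R^d
   for nonnegative, resp. integrable, measurable integrands). *)
Fixpoint iint (n : nat) : ('rV[R]_n -> \bar R) -> \bar R :=
  match n return ('rV[R]_n -> \bar R) -> \bar R with
  | 0 => fun f => f 0
  | n'.+1 => fun f : 'rV[R]_(1 + n') -> \bar R =>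
      (\int[@lebesgue_measure R]_(x in [set: R])
        @iint n' (fun v : 'rV[R]_n' => f (row_mx (\row_(_ < 1) x) v)))%E
  end.

Definition sqnorm d (z : 'rV[R]_d) : R := \sum_(i < d) z 0 i ^+ 2.

Definition phi d (s2 : R) (z : 'rV[R]_d) : R :=
  (2 * pi * s2) `^ (- (d%:R) / 2) * expR (- sqnorm z / (2 * s2)).

Definition marg d (prior : 'rV[R]_d -> R) (x : 'rV[R]_d) (v : R) : \bar R :=
  iint (fun mu => (phi v (x - mu) * prior mu)%:E).

(* real-valued version (meaningful when marg is finite) *)
Definition margR d (prior : 'rV[R]_d -> R) (x : 'rV[R]_d) (v : R) : R :=
  fine (marg prior x v).

Definition EZ d (g : 'rV[R]_d -> R) : \bar R :=
  iint (fun z => (g z * phi 1 z)%:E).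

Definition ebasis d (i : 'I_d) : 'rV[R]_d := delta_mx 0 i.

Definition lap d (f : 'rV[R]_d -> R) (u : 'rV[R]_d) : R :=
  \sum_(i < d) 'D_(ebasis i) ('D_(ebasis i) f) u.

Definition beta (alpha : R) : R := (1 - alpha) / 2.
Definition kappa (alpha : R) : R := (Num.floor (1 / beta alpha) + 1)%:~R.
Definition cbeta (alpha : R) : R := (kappa alpha - 1 / beta alpha + 1) / 2.
Definition gam (alpha vx vy : R) : R := 1 / (1 + beta alpha * vx / vy).
Definition xi (alpha vx vy : R) : R :=
  (1 - gam alpha vx vy) * Num.sqrt (vy / gam alpha vx vy).

Definition pred_bayes d (prior : 'rV[R]_d -> R) (alpha vx vy : R)
    (x y : 'rV[R]_d) : R :=
  let g := gam alpha vx vy in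
  let b := beta alpha in
  let M := fun w => margR prior w (vx * g) in
  (M (g *: x + (1 - g) *: y)) `^ (1 / b)
    / fine (EZ (fun z => (M (x + xi alpha vx vy *: z)) `^ (1 / b)))
    * phi (vy / g) (y - x).

Definition pred_unif d (alpha vx vy : R) (x y : 'rV[R]_d) : R :=
  phi (vy + beta alpha * vx) (y - x).

Definition falpha (alpha z : R) : R :=
  4 / (1 - alpha ^+ 2) * (1 - z `^ ((1 + alpha) / 2)).

Definition Dalpha d (alpha vy : R) (p : 'rV[R]_d -> 'rV[R]_d -> R)
    (x mu : 'rV[R]_d) : \bar R :=
  iint (fun y => (falpha alpha (p x y / phi vy (y - mu)) * phi vy (y - mu))%:E).

Definition risk d (alpha vx vy : R) (p : 'rV[R]_d -> 'rV[R]_d -> R)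
    (mu : 'rV[R]_d) : \bar R :=
  iint (fun x => (Dalpha alpha vy p x mu * (phi vx (x - mu))%:E)%E).

Definition regular_prior d (prior : 'rV[R]_d -> R) (v : R) : Prop :=
  let M := fun w => margR prior w v in
  (forall mu, 0 <= prior mu) /\
      (forall x, (0 < marg prior x v < +oo)%E) /\
      (forall x, differentiable M x) /\
      (forall i x, differentiable ('D_(ebasis i) M) x) /\
      (forall i j, continuous ('D_(ebasis j) ('D_(ebasis i) M))) /\
      (forall (a t : R) (u : 'rV[R]_d), 0 < a -> 0 <= t ->
         (EZ (fun z => ((M (t *: z + u)) `^ a)%R) < +oo)%E) /\
      (forall (a t : R), 0 < a -> 0 <= t ->
        let g := fun w => (M w) `^ a in
        let h := fun u => fine (EZ (fun z => g (t *: z + u))) in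
        (forall u, differentiable h u) /\
        (forall i u, differentiable ('D_(ebasis i) h) u) /\
        (forall i u, 'D_(ebasis i) h u =
            fine (EZ (fun z => 'D_(ebasis i) g (t *: z + u)))) /\
        (forall i j u, 'D_(ebasis j) ('D_(ebasis i) h) u =
            fine (EZ (fun z => 'D_(ebasis j) ('D_(ebasis i) g) (t *: z + u)))) /\
        (forall u : 'rV[R]_d, 0 < t ->
           derivable (fun s : R => fine (EZ (fun z => g (s *: z + u)))) t 1 /\
           derive1 (fun s : R => fine (EZ (fun z => g (s *: z + u)))) t =
             fine (EZ (fun z => \sum_(i < d) z 0 i *
                                 'D_(ebasis i) g (t *: z + u))))).

End Defs.

(* Main.v *)
Require Import Defs.
From HB Require Import structures.
From mathcomp Require Import all_boot all_order all_algebra.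
From mathcomp Require Import all_classical all_reals all_analysis.
From mathcomp Require Import measurable_realfun ring lra.
Import Order.TTheory GRing.Theory Num.Def Num.Theory.
Import numFieldNormedType.Exports.
Set Implicit Arguments.
Unset Strict Implicit.
Unset Printing Implicit Defensive.
Local Open Scope classical_set_scope.
Local Open Scope ring_scope.

(** Write [q = 1/beta], [M = m_pi(., vx gamma)], [N(x) = E[M^q(x + xi Z)]] and
    [a = (q - 1)/kappa].  Both risks have the form [C - I(p)].  After the change of
    variables [w = gamma x + (1 - gamma) y] the Gaussian factors of [I(p)] become
    [phi(w - mu, vx gamma) phi(x - w, xi^2)], so it is enough to show
      [E[N(w + xi Z)^-(1 - beta)] >= M(w)^-(q - 1)]  for every [w].
    By Lyapunov's inequality [N <= (E[M^kappa(. + xi Z)])^(q/kappa)], which reduces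
    this to [P_S (H_S^-a) >= H_0^-a], where [P] is the heat semigroup,
    [H_s = P_s M^kappa] and [S = xi^2].  The function [u = H^-a] satisfies
    [d_s u + (1/2) Delta u >= 0] exactly when [Delta H^((1 - a)/2) <= 0], and
    [(1 - a)/2 = c(beta)/kappa]: this is the hypothesis.  The inequality then follows
    from the maximum principle for the backward heat equation on the whole space,
    with barrier [e^(L(S - s)) (1 + |x|^2)^k].  The polynomial growth of [u] that this
    needs comes from the hypothesis once more: a positive superharmonic function is
    bounded below by a multiple of [(1 + |x|^2)^-d]. *)

(** * Integration on R^n *)

Section Measure.
Variable R : realType.

(** Formally [P_s (H_s^-a)] increases in s, because its derivative is P_s applied to
    [d_s u + (1/2) Delta u]. Differentiating this integral would require bounds on the derivatives
    of [H_s^-a], which the hypotheses do not supply; the maximum principle asks only for the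
    pointwise inequality and for growth. With [b = (1 - a)/2] the two sign conditions have the same
    bracket: [d_s u + (1/2) Delta u = - a H^(-a-2) (H Delta H + (b - 1) |grad H|^2)] and [Delta H^b
    = b H^(b-2) (H Delta H + (b - 1) |grad H|^2)]. Every derivative of the flow is put on the
    Gaussian kernel, so the only facts used about the initial function are its continuity, its sign
    and its integrability against all Gaussians. *)

Lemma open_preimage_measurable (dO : measure_display) (O : measurableType dO)
    n (F : O -> 'rV[R]_n) (A : set 'rV[R]_n) :
  (forall i, measurable_fun setT (fun w => F w 0 i)) -> open A ->
  measurable (F @^-1` A).
Proof.
move=> mF oA.
pose q (p : 'rV[rat]_n) : 'rV[R]_n := map_mx ratr p.
pose r (k : nat) : R := k.+1%:R^-1.
have r0 k : 0 < r k by rewrite invr_gt0.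
(* An open set is the union of the sup-norm balls inside it with rational centre and radius
   [1/(k+1)]. Sending the other balls to [set0] keeps a countable index type, and the preimage of a
   ball is a finite intersection of coordinate preimages. *)
pose B (p : 'rV[rat]_n * nat) : set O :=
  if `[< ball (q p.1) (r p.2) `<=` A >] then F @^-1` (ball (q p.1) (r p.2))
  else set0.
have -> : F @^-1` A = \bigcup_p B p.
  apply/seteqP; split => [w Aw|w [p _]]; last first.
    rewrite /B; case: ifPn => // /asboolP sub; exact: sub.
  have /nbhs_ballP[e /= e0 eA] : nbhs (F w) A by exact: oA.
  have [k rk] : exists k, r k < e / 2.
    have e20 : 0 < e / 2 by rewrite divr_gt0.
    by have [k /= ke] := @ltr_add_invr R 0 (e/2) e20; exists k; rewrite add0r in ke.
  have /choice[p pP] : forall i, exists c : rat, `|ratr c - F w 0 i| < r k.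
    move=> i; have /rat_in_itvoo[c] : F w 0 i - r k < F w 0 i + r k.
      by rewrite ltrD2l gtrN.
    rewrite in_itv/= => /andP[c1 c2]; exists c.
    by rewrite ltr_norml ltrBrDr ltrBlDr addrC c1/= addrC.
  have Fb : ball (q (\row_i p i)) (r k) (F w).
    by split => // i j; rewrite !mxE (ord1 i) /ball/= .
  exists (\row_i p i, k) => //; rewrite /B; case: ifPn => //= /asboolPn; case.
  move=> y By; apply: eA; have := ball_triangle (ball_sym Fb) By.
  apply: le_ball; move: rk; lra.
apply: countable_bigcupT_measurable.
  exact: countableP.
move=> [p k]; rewrite /B; case: ifPn => // _.
have -> : F @^-1` ball (q p) (r k) =
    \bigcap_(i in [set: 'I_n]) ((fun w => F w 0 i) @^-1` ball (q p 0 i) (r k)).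
  apply/seteqP; split => [w /= [_ H] i _|w H]; first exact: H.
  by split => // i j; rewrite (ord1 i); exact: H.
apply: fin_bigcap_measurable => // i _.
rewrite -[X in measurable X]setTI; apply: mF => //.
apply: open_measurable; exact: ball_open.
Qed.

Lemma measurable_continuous_comp (dO : measure_display) (O : measurableType dO)
    n (F : O -> 'rV[R]_n) (f : 'rV[R]_n -> R) :
  (forall i, measurable_fun setT (fun w => F w 0 i)) -> continuous f ->
  measurable_fun setT (fun w => f (F w)).
Proof.
move=> mF /continuousP cf; apply: (measurability _ (RGenOpens.measurableE R)).
move=> _ [_ [a [b ->] <-]]; rewrite setTI.
apply: (@open_preimage_measurable _ _ _ F (f @^-1` `]a, b[%classic)) => //.
exact/cf/interval_open.
Qed.

(** Bundles display, carrier and measure, since [euclid] produces all three by a single recursion on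
    the dimension. *)
Record mspace := MSpace {
  ms_disp : measure_display;
  ms_sort : measurableType ms_disp;
  ms_mu : {sigma_finite_measure set ms_sort -> \bar R} }.

Section Step.
Local Open Scope ereal_scope.
Variable X : mspace.

Definition step_mu : set (measurableTypeR R * ms_sort X) -> \bar R :=
  @lebesgue_measure R \x ms_mu X.

HB.instance Definition _ := Measure.on step_mu.

(** Both exhausting sequences are taken nondecreasing, so a point of [F n * G k] already lies in the
    rectangle of index [maxn n k]. *)
Let step_mu_sigma_finite : sigma_finite setT step_mu.
Proof.
have /sigma_finiteP[F [TF ndF Foo]] := sigma_finiteT (@lebesgue_measure R).
have /sigma_finiteP[G [TG ndG Goo]] := sigma_finiteT (ms_mu X).
exists (fun n => F n `*` G n).
  apply/seteqP; split => // -[x y] _.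
  have [n _ Fx] : (\bigcup_n F n) x by rewrite -TF.
  have [k _ Gy] : (\bigcup_n G n) y by rewrite -TG.
  exists (maxn n k) => //; split => /=.
    by have /subsetPset := ndF _ _ (leq_maxl n k); apply.
  by have /subsetPset := ndG _ _ (leq_maxr n k); apply.
move=> n; have [mF Fn] := Foo n; have [mG Gn] := Goo n.
split; first exact: measurableX.
by rewrite /step_mu product_measure1E// lte_mul_pinfty// ge0_fin_numE.
Qed.

HB.instance Definition _ :=
  Measure_isSigmaFinite.Build _ _ _ step_mu step_mu_sigma_finite.

Definition step_space : mspace :=
  @MSpace _ (measurableTypeR R * ms_sort X)%type step_mu.

End Step.

(* [R^n] as the iterated product [R * (R * ...)], so that Tonelli's theorem matches
   the recursion of [iint]; [toV] identifies it with row vectors. *)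
Fixpoint euclid (n : nat) : mspace :=
  if n is n'.+1 then step_space (euclid n')
  else @MSpace _ unit (@dirac _ unit tt R).

Fixpoint toV (n : nat) : ms_sort (euclid n) -> 'rV[R]_n :=
  match n return ms_sort (euclid n) -> 'rV[R]_n with
  | 0 => fun=> 0
  | n'.+1 => fun p => row_mx (\row_(_ < 1) p.1) (@toV n' p.2)
  end.

Lemma row_mx_l (x : R) n (v : 'rV[R]_n) (j : 'I_1) :
  (row_mx (\row_(_ < 1) x) v : 'rV[R]_n.+1) 0 (lshift n j) = x.
Proof. by have := @row_mxEl R 1 1 n (\row_(_ < 1) x) v 0 j; rewrite mxE. Qed.

Lemma row_mx_r (x : R) n (v : 'rV[R]_n) (j : 'I_n) :
  (row_mx (\row_(_ < 1) x) v : 'rV[R]_n.+1) 0 (rshift 1 j) = v 0 j.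
Proof. exact: (@row_mxEr R 1 1 n). Qed.

Lemma measurable_toV n (i : 'I_n) : measurable_fun setT (fun t => @toV n t 0 i).
Proof.
elim: n i => [[]//|n IH] i.
case: (@split_ordP 1 n i) => j ->.
  rewrite (_ : (fun t => _) = fst); first exact: measurable_fst.
  by apply/funext => t; exact: row_mx_l.
rewrite (_ : (fun t => _) = (fun t => @toV n t 0 j) \o snd).
  exact: measurableT_comp.
by apply/funext => t; exact: row_mx_r.
Qed.

End Measure.

Section Integral.
Variable R : realType.
Local Notation mu := (@lebesgue_measure R).

(** A single integral for the product measure, to which Fatou's lemma and differentiation under the
    integral apply; [iintE] identifies it with the iterated [iint] for nonnegative measurable
    integrands. *)
Definition intV n (f : 'rV[R]_n -> \bar R) : \bar R :=
  (\int[ms_mu (euclid R n)]_t f (toV t))%E.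

Lemma measurable_toV_comp n (f : 'rV[R]_n -> R) :
  continuous f -> measurable_fun setT (fun t => f (@toV R n t)).
Proof. by move=> cf; apply: measurable_continuous_comp => // i; exact: measurable_toV. Qed.

Lemma measurable_toV_compE n (f : 'rV[R]_n -> R) :
  continuous f -> measurable_fun setT (fun t => (f (@toV R n t))%:E).
Proof. by move=> /measurable_toV_comp mf; exact/measurable_EFinP. Qed.

Lemma measurable_section n (f : 'rV[R]_n.+1 -> \bar R) :
  measurable_fun setT (fun t => f (@toV R n.+1 t)) ->
  forall x : R, measurable_fun setT
    (fun t => f (row_mx (\row_(_ < 1) x) (@toV R n t))).
Proof.
move=> mf x; exact: (measurableT_comp mf (measurable_pair1 x)).
Qed.

Lemma measurable_intV_section n (f : 'rV[R]_n.+1 -> \bar R) :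
  (forall v, 0 <= f v)%E ->
  measurable_fun setT (fun t => f (@toV R n.+1 t)) ->
  measurable_fun setT (fun x : R => intV (fun v : 'rV[R]_n =>
    f (row_mx (\row_(_ < 1) x) v))).
Proof.
move=> f0 mf.
exact: (@measurable_fun_fubini_tonelli_F _ _ _ _ _ _
  (fun t => f (@toV R n.+1 t)) mf (fun t => f0 _)).
Qed.

Lemma intVS n (f : 'rV[R]_n.+1 -> \bar R) :
  (forall v, 0 <= f v)%E ->
  measurable_fun setT (fun t => f (@toV R n.+1 t)) ->
  intV f = (\int[mu]_x intV (fun v : 'rV[R]_n =>
    f (row_mx (\row_(_ < 1) x) v)))%E.
Proof.
move=> f0 mf.
exact: (@fubini_tonelli1 _ _ _ _ _ mu (ms_mu (euclid R n))
  (fun t => f (@toV R n.+1 t)) mf (fun t => f0 _)).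
Qed.

Lemma intV0 (f : 'rV[R]_0 -> \bar R) : intV f = f 0.
Proof.
rewrite /intV /= integral_dirac//; last first.
by rewrite diracT mul1e.
Qed.

Lemma iintE n (f : 'rV[R]_n -> \bar R) :
  (forall v, 0 <= f v)%E -> measurable_fun setT (fun t => f (@toV R n t)) ->
  iint f = intV f.
Proof.
elim: n f => [|n IH] f f0 mf; first by rewrite intV0.
rewrite intVS//=; apply: eq_integral => x _; rewrite IH//.
exact: measurable_section.
Qed.

(** If B has infinite integral, both sides are [-oo]: the positive part of A - B is at most A, and
    [B <= (A - B)^- + A] forces the negative part to have infinite integral. *)
Lemma integral_ge0B (dT : measure_display) (T : measurableType dT)
    (m : {measure set T -> \bar R}) (A B : T -> \bar R) :
  measurable_fun setT A -> measurable_fun setT B ->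
  (forall x, 0 <= A x)%E -> (forall x, A x < +oo)%E -> (forall x, 0 <= B x)%E ->
  (\int[m]_x A x < +oo)%E ->
  (\int[m]_x (A x - B x) = \int[m]_x A x - \int[m]_x B x)%E.
Proof.
move=> mA mB A0 Afin B0 intA.
have iA : m.-integrable setT A.
  by apply/integrableP; split => //; under eq_integral do rewrite gee0_abs//.
have [intB|] := boolP (\int[m]_x B x < +oo)%E.
  rewrite integralB//; apply/integrableP; split => //.
  by under eq_integral do rewrite gee0_abs//.
rewrite -leNgt leye_eq => /eqP intB; rewrite intB.
have mAB : measurable_fun setT (fun x => A x - B x)%E by exact: emeasurable_funB.
have posle : (\int[m]_x (fun x => A x - B x)^\+ x <= \int[m]_x A x)%E.
  apply: ge0_le_integral => //.
    exact: measurable_funepos.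
  move=> x _; rewrite funeposE ge_max A0 andbT.
  by rewrite -[leRHS]adde0 leeD2l// oppe_le0.
have negoo : (\int[m]_x (fun x => A x - B x)^\- x = +oo)%E.
  apply/eqP; rewrite -leye_eq leNgt; apply/negP => nlt.
  have : (\int[m]_x B x <= \int[m]_x (fun x => A x - B x)^\- x + \int[m]_x A x)%E.
    rewrite -ge0_integralD//; last exact: measurable_funeneg.
    apply: ge0_le_integral => //.
    - by apply: emeasurable_funD => //; exact: measurable_funeneg.
    move=> x _; rewrite funenegE.
    move: (Afin x) (A0 x) (B0 x); case: (A x) => [a| |]// _ _.
    case: (B x) => [b| |]//= _.
      by rewrite -EFin_max -EFinD lee_fin -lerBlDr le_max opprB lexx.
  rewrite intB leye_eq => /eqP H.
  by have := lte_add_pinfty nlt intA; rewrite H ltxx.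
rewrite integralE negoo.
have pos0 : (0 <= \int[m]_x (fun x => A x - B x)^\+ x)%E by exact: integral_ge0.
have iA0 : (0 <= \int[m]_x A x)%E by exact: integral_ge0.
have plt := le_lt_trans posle intA; move: plt pos0 intA iA0.
set P := (\int[m]_x _^\+ x)%E; set Q := (\int[m]_x A x)%E.
by case: P => // p _ _; case: Q.
Qed.

Section Continuity.
Variables (T : topologicalType) (x : T) (f g : T -> R).

Lemma continuous_at_cst (c : R) : {for x, continuous (fun _ : T => c)}.
Proof. exact: cvg_cst. Qed.

Hypothesis cf : {for x, continuous f}.

Lemma continuous_atN : {for x, continuous (fun y => - f y)}.
Proof. exact: cvgN. Qed.

Lemma continuous_at_comp (h : R -> R) : {for f x, continuous h} ->
  {for x, continuous (fun y => h (f y))}.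
Proof. exact: continuous_comp. Qed.

Hypothesis cg : {for x, continuous g}.

Lemma continuous_atM : {for x, continuous (fun y => f y * g y)}.
Proof. exact: cvgM. Qed.

Lemma continuous_atD : {for x, continuous (fun y => f y + g y)}.
Proof. exact: cvgD. Qed.

End Continuity.

Lemma continuous_bigsum (T : topologicalType) n (G : 'I_n -> T -> R) :
  (forall i, continuous (G i)) -> continuous (fun z => \sum_(i < n) G i z).
Proof.
elim: n G => [|n IH] G cG.
  under eq_fun do rewrite big_ord0; exact: cst_continuous.
under eq_fun do rewrite big_ord_recr/=.
by move=> z; apply: cvgD; [exact: IH|exact: cG].
Qed.

Lemma mulf_continuous n (f g : 'rV[R]_n -> R) :
  continuous f -> continuous g -> continuous (fun y : 'rV[R]_n => f y * g y).
Proof. by move=> cf cg v; exact: (continuous_atM (cf v) (cg v)). Qed.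

Lemma sqnorm_continuous n : continuous (@sqnorm R n).
Proof.
apply: continuous_bigsum => i z.
under eq_fun do rewrite expr2.
by apply: continuous_atM; exact: coord_continuous.
Qed.

Lemma phi_continuous n (s : R) : continuous (@phi R n s).
Proof.
rewrite (_ : phi s = fun z =>
  (2 * pi * s) `^ (- n%:R / 2) * expR (- sqnorm z / (2 * s)))//.
move=> z; apply: (@continuous_atM 'rV[R]_n); first exact: continuous_at_cst.
apply: (@continuous_at_comp 'rV[R]_n); last exact: continuous_expR.
apply: (@continuous_atM 'rV[R]_n); last exact: continuous_at_cst.
by apply: (@continuous_atN 'rV[R]_n); exact: sqnorm_continuous.
Qed.

Lemma comp_sub_continuous n (f : 'rV[R]_n -> R) (m : 'rV[R]_n) :
  continuous f -> continuous (fun z : 'rV[R]_n => f (z - m)).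
Proof.
move=> cf z; apply: (@continuous_comp _ _ _ (fun z : 'rV[R]_n => z - m) f).
  by apply: (@cvgB _ _ _ (nbhs z) _ id (fun=> m)); [exact: cvg_id|exact: cvg_cst].
exact: cf.
Qed.

Lemma phiB_continuous n (s : R) (m : 'rV[R]_n) :
  continuous (fun z : 'rV[R]_n => phi s (z - m)).
Proof.
exact: (@comp_sub_continuous n (phi s) m (@phi_continuous n s)).
Qed.

Lemma measurable_phiB n (s : R) (m : 'rV[R]_n) :
  measurable_fun setT (fun t => (phi s (@toV R n t - m))%:E).
Proof. exact: (measurable_toV_compE (@phiB_continuous n s m)). Qed.

Lemma phi_gt0 n (s : R) (z : 'rV[R]_n) : 0 < s -> 0 < phi s z.
Proof. by move=> s0; rewrite mulr_gt0 ?expR_gt0// powR_gt0 ?mulr_gt0 ?pi_gt0. Qed.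

Lemma phi_ge0 n (s : R) (z : 'rV[R]_n) : 0 <= phi s z.
Proof. by rewrite mulr_ge0 ?expR_ge0 ?powR_ge0. Qed.

Lemma sqnorm_ge0 n (z : 'rV[R]_n) : 0 <= sqnorm z.
Proof. by apply: sumr_ge0 => i _; exact: sqr_ge0. Qed.

Lemma sqnorm_row_mx (x : R) n (v : 'rV[R]_n) (m : 'rV[R]_n.+1) :
  sqnorm ((row_mx (\row_(_ < 1) x) v : 'rV[R]_n.+1) - m) =
  (x - m 0 0) ^+ 2 + sqnorm (v - rsubmx (m : 'rV[R]_(1 + n))).
Proof.
rewrite /sqnorm (@big_split_ord _ _ _ 1 n)/= big_ord1; congr (_ + _).
  by rewrite mxE row_mx_l mxE; congr ((_ - m _ _) ^+ 2); exact/val_inj.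
by apply: eq_bigr => i _; rewrite mxE row_mx_r !mxE.
Qed.

Lemma phi_row_mx (s : R) (x : R) n (v : 'rV[R]_n) (m : 'rV[R]_n.+1) : 0 < s ->
  phi s ((row_mx (\row_(_ < 1) x) v : 'rV[R]_n.+1) - m) =
  normal_pdf (m 0 0) (Num.sqrt s) x * phi s (v - rsubmx (m : 'rV[R]_(1 + n))).
Proof.
move=> s0; rewrite /phi sqnorm_row_mx /normal_pdf gt_eqF ?sqrtr_gt0//.
rewrite /normal_peak /normal_fun sqr_sqrtr ?ltW// (opprD (_ ^+ 2)) (mulrDl (- _ ^+ 2)) expRD.
have -> : s * pi *+ 2 = 2 * pi * s by rewrite -mulr_natl; ring.
have -> : s *+ 2 = 2 * s by rewrite -mulr_natl; ring.
have p0 : 0 < 2 * pi * s by rewrite !mulr_gt0 ?pi_gt0.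
have -> : - n.+1%:R / 2 = - 2^-1 + - n%:R / 2 :> R by rewrite -natr1; field.
rewrite powRD; last by rewrite (gt_eqF p0)/= implybT.
rewrite (powRN _ 2^-1) powR12_sqrt ?ltW//; ring.
Qed.

Lemma intV_phi n (s : R) (m : 'rV[R]_n) : 0 < s ->
  intV (fun v => (phi s (v - m))%:E) = 1%E.
Proof.
move=> s0; elim: n m => [|n IH] m.
  by rewrite intV0 /phi /sqnorm big_ord0 !(oppr0, mul0r) expR0 mulr1 powRr0.
rewrite intVS; last 2 first.
- by move=> v; rewrite lee_fin phi_ge0.
- exact: measurable_phiB.
rewrite -(integral_normal_pdf (m 0 0) (Num.sqrt s)); apply: eq_integral => x _.
under [LHS]eq_integral do rewrite phi_row_mx// EFinM.
rewrite ge0_integralZl//.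
- by rewrite [X in (_ * X)%E](IH (rsubmx (m : 'rV[R]_(1 + n)))) mule1.
- exact: measurable_phiB.
- by move=> t _; rewrite lee_fin phi_ge0.
- by rewrite lee_fin normal_pdf_ge0.
Qed.

Lemma intV_cphi n (c s : R) (m : 'rV[R]_n) : 0 <= c -> 0 < s ->
  intV (fun v => (c * phi s (v - m))%:E) = c%:E.
Proof.
move=> c0 s0; rewrite /intV; under eq_integral do rewrite EFinM.
rewrite ge0_integralZl//; last 2 first.
- exact: measurable_phiB.
- by move=> t _; rewrite lee_fin phi_ge0.
by rewrite -/(intV (fun v => (phi s (v - m))%:E)) intV_phi// mule1.
Qed.

(* The sections of [B] need not be integrable, hence the Gaussian minuend. *)
Lemma iint_cphiB n (c s : R) (m : 'rV[R]_n) (B : 'rV[R]_n -> \bar R) :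
  0 <= c -> 0 < s -> (forall v, 0 <= B v)%E ->
  measurable_fun setT (fun t => B (@toV R n t)) ->
  (iint (fun v => (c * phi s (v - m))%:E - B v) = c%:E - intV B)%E.
Proof.
move=> c0 s0; elim: n m c c0 B => [|n IH] m c c0 B B0 mB.
  rewrite intV0 /= /phi /sqnorm big_ord0 !(oppr0, mul0r) expR0 powRr0 !mulr1//.
rewrite intVS//=.
have E x : (iint (fun v : 'rV[R]_n =>
     (c * phi s ((row_mx (\row_(_ < 1) x) v : 'rV[R]_n.+1) - m))%:E -
       B (row_mx (\row_(_ < 1) x) v)) =
     (c * normal_pdf (m 0 0) (Num.sqrt s) x)%:E -
       intV (fun v => B (row_mx (\row_(_ < 1) x) v)))%E.
  rewrite -(IH (rsubmx (m : 'rV[R]_(1 + n))))//; last 2 first.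
  - by rewrite mulr_ge0// normal_pdf_ge0.
  - exact: measurable_section.
  by congr iint; apply/funext => v; rewrite phi_row_mx// mulrA.
under eq_integral do rewrite E.
have intN : (\int[mu]_x (c * normal_pdf (m 0 0) (Num.sqrt s) x)%:E = c%:E)%E.
  under eq_integral do rewrite EFinM.
  rewrite ge0_integralZl//; last 2 first.
  - by apply/measurable_EFinP; exact: measurable_normal_pdf.
  - by move=> t _; rewrite lee_fin normal_pdf_ge0.
  by rewrite integral_normal_pdf mule1.
rewrite integral_ge0B ?intN ?ltry//.
- apply/measurable_EFinP; apply: measurable_funM => //.
  exact: measurable_normal_pdf.
- exact: measurable_intV_section.
- by move=> x; rewrite lee_fin mulr_ge0// normal_pdf_ge0.
- by move=> x; rewrite ltry.
- by move=> x; exact: integral_ge0.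
Qed.

Lemma row_mx_continuous n (x : R) :
  continuous (fun v : 'rV[R]_n => row_mx (\row_(_ < 1) x) v : 'rV[R]_n.+1).
Proof.
move=> v A /nbhs_ballP[e /= e0 eA]; apply/nbhs_ballP; exists e => //= w [_ vw].
apply: eA; split => // i j; rewrite (ord1 i); case: (@split_ordP 1 n j) => k ->.
  by rewrite !row_mx_l; exact: ballxx.
by rewrite !row_mx_r.
Qed.

Lemma affine_continuous n (a : R) (b : 'rV[R]_n) :
  continuous (fun v : 'rV[R]_n => a *: v + b).
Proof.
move=> v; apply: (@cvgD _ _ _ (nbhs v) _ (fun v => a *: v) (fun=> b)).
  exact: scaler_continuous.
exact: cvg_cst.
Qed.

Lemma comp_affine_continuous n (f : 'rV[R]_n -> R) (a : R) (b : 'rV[R]_n) :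
  continuous f -> continuous (fun v : 'rV[R]_n => f (a *: v + b)).
Proof.
move=> cf v; apply: (@continuous_comp _ _ _ (fun v : 'rV[R]_n => a *: v + b) f).
  exact: affine_continuous.
exact: cf.
Qed.

(** The image of Lebesgue measure under [x |-> a x + b], multiplied by a, gives each half-open
    interval its length, so by uniqueness it is Lebesgue measure. *)
Lemma integral_affine (f : R -> \bar R) (a b : R) :
  measurable_fun setT f -> (forall x, 0 <= f x)%E -> 0 < a ->
  (\int[mu]_x f x = a%:E * \int[mu]_x f (a * x + b)%R)%E.
Proof.
move=> mf f0 a0.
pose h : measurableTypeR R -> measurableTypeR R := fun x => a * x + b.
have mh : measurable_fun setT h.
  apply: measurable_funD => //; apply: measurable_funM => //.
pose pm : {measure set (measurableTypeR R) -> \bar R} :=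
  measure_function_pushforward__canonical__measure_function_Measure mu mh.
pose nu := mscale (NngNum (ltW a0)) pm.
have nuE A : measurable A -> mu A = nu A.
  apply: lebesgue_measure_unique => _ [[c d]] _ <-.
  change (mu `]c, d]%classic = a%:E * mu (h @^-1` `]c, d]%classic))%E.
  have -> : h @^-1` `]c, d]%classic = `](c - b) / a, (d - b) / a]%classic.
    apply/seteqP; split => x; rewrite /h /= !in_itv/= ltr_pdivrMr// ler_pdivlMr//;
      move=> /andP[? ?]; apply/andP; split; lra.
  rewrite !lebesgue_measure_itv/= !lte_fin ltr_pM2r ?invr_gt0// ltrD2r.
  case: ifPn => _; last by rewrite mule0.
  by rewrite -!EFinD -EFinM; congr EFin; field; rewrite gt_eqF.
transitivity (\int[nu]_x f x)%E.
  by apply: eq_measure_integral => A mA _; exact: nuE.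
rewrite ge0_integral_mscale//; congr (_ * _)%E.
by rewrite ge0_integral_pushforward.
Qed.

Lemma intV_affine n (f : 'rV[R]_n -> R) (a : R) (b : 'rV[R]_n) :
  continuous f -> (forall v, 0 <= f v) -> 0 < a ->
  (intV (fun v => (f v)%:E) = (a ^+ n)%:E * intV (fun v => (f (a *: v + b))%:E))%E.
Proof.
move=> + + a0; elim: n f b => [|n IH] f b cf f0.
  by rewrite !intV0 expr0 mul1e; congr (f _)%:E; apply/matrixP => ? [].
have cfa := @comp_affine_continuous _ f a b cf.
rewrite intVS; last 2 first.
- by move=> v; rewrite lee_fin.
- exact: measurable_toV_compE.
rewrite (@integral_affine _ a (b 0 0))//; last 2 first.
- apply: (@measurable_intV_section n (fun v => (f v)%:E)).
    by move=> v; rewrite lee_fin.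
  exact: measurable_toV_compE.
- by move=> x; apply: integral_ge0 => t _; rewrite lee_fin.
rewrite intVS; last 2 first.
- by move=> v; rewrite lee_fin.
- exact: (measurable_toV_compE cfa).
rewrite exprS EFinM -muleA; congr (_ * _)%E.
rewrite -ge0_integralZl//; last 3 first.
- apply: (@measurable_intV_section n (fun v => (f (a *: v + b))%:E)).
    by move=> v; rewrite lee_fin.
  exact: (measurable_toV_compE cfa).
- by move=> x _; apply: integral_ge0 => t _; rewrite lee_fin.
- by rewrite lee_fin exprn_ge0// ltW.
apply: eq_integral => x _.
rewrite (IH (fun v => f (row_mx (\row_(_ < 1) (a * x + b 0 0)) v))
  (rsubmx (b : 'rV[R]_(1 + n))))//; last first.
  move=> v; apply: (@continuous_comp _ _ _
    (fun v => row_mx (\row_(_ < 1) (a * x + b 0 0)) v : 'rV[R]_n.+1) f).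
    exact: row_mx_continuous.
  exact: cf.
congr (_ * _)%E; congr intV; apply/funext => v; congr (f _)%:E.
apply/rowP => j; case: (@split_ordP 1 n j) => k ->.
  apply: etrans (row_mx_l _ _ _) _; rewrite mxE [X in _ = X + _]mxE.
  by congr (a * _ + b _ _); [exact/esym/row_mx_l|rewrite (ord1 k); exact/val_inj].
apply: etrans (row_mx_r _ _ _) _.
rewrite [LHS]mxE [X in X + _]mxE [X in _ + X]mxE [RHS]mxE [X in _ = X + _]mxE.
by congr (a * _ + _); exact/esym/row_mx_r.
Qed.

Lemma intV_swap n k (f : 'rV[R]_n -> 'rV[R]_k -> \bar R) :
  measurable_fun setT (fun p => f (@toV R n p.1) (@toV R k p.2)) ->
  (forall x y, 0 <= f x y)%E ->
  intV (fun x => intV (f x)) = intV (fun y => intV (f^~ y)).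
Proof.
move=> mf f0.
exact: (@fubini_tonelli _ _ _ _ _ (ms_mu (euclid R n)) (ms_mu (euclid R k))
  (fun p => f (toV p.1) (toV p.2)) mf (fun p => f0 _ _)).
Qed.

Lemma measurable_intV n k (f : 'rV[R]_n -> 'rV[R]_k -> \bar R) :
  measurable_fun setT (fun p => f (@toV R n p.1) (@toV R k p.2)) ->
  (forall x y, 0 <= f x y)%E ->
  measurable_fun setT (fun t => intV (f (@toV R n t))).
Proof.
move=> mf f0.
exact: (@measurable_fun_fubini_tonelli_F _ _ _ _ _ (ms_mu (euclid R k))
  (fun p => f (toV p.1) (toV p.2)) mf (fun p => f0 _ _)).
Qed.

End Integral.

(** * The heat semigroup *)

Section Heat.
Variable R : realType.

Lemma sqnormZ n (t : R) (z : 'rV[R]_n) : sqnorm (t *: z) = t ^+ 2 * sqnorm z.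
Proof. by rewrite /sqnorm mulr_sumr; apply: eq_bigr => i _; rewrite mxE exprMn. Qed.

Lemma phi_scale n (t : R) (z : 'rV[R]_n) : 0 < t ->
  t ^+ n * phi (t ^+ 2) (t *: z) = phi 1 z.
Proof.
move=> t0; rewrite /phi sqnormZ.
have t2 : 0 < t ^+ 2 by rewrite exprn_gt0.
have -> : - (t ^+ 2 * sqnorm z) / (2 * t ^+ 2) = - sqnorm z / (2 * 1).
  by field; rewrite gt_eqF.
rewrite mulrA; congr (_ * _).
rewrite (powRM _ (_ : 0 <= 2 * pi)) ?(ltW t2) ?mulr_ge0 ?pi_ge0// mulr1 mulrCA.
rewrite -[RHS]mulr1; congr (_ * _).
rewrite -!powR_mulrn ?ltW// -powRrM -powRD; last by rewrite (gt_eqF t0)/= implybT.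
by rewrite (_ : n%:R + _ = 0) ?powRr0//; field.
Qed.

(** Substituting [y = t z + x] moves the dependence on t and x from f to the kernel, so that
    derivatives in both fall on a Gaussian. *)
Lemma EZ_phi n (f : 'rV[R]_n -> R) (t : R) (x : 'rV[R]_n) :
  continuous f -> (forall v, 0 <= f v) -> 0 < t ->
  EZ (fun z => f (t *: z + x)) = intV (fun y => (f y * phi (t ^+ 2) (y - x))%:E).
Proof.
move=> cf f0 t0; rewrite /EZ iintE.
- rewrite (@intV_affine _ _ (fun y => f y * phi (t ^+ 2) (y - x)) t x)//.
  + rewrite /intV -ge0_integralZl//.
    * apply: eq_integral => u _; rewrite -EFinM; congr EFin.
      by rewrite addrK [RHS]mulrCA phi_scale.
    * apply: (@measurable_toV_compE _ _ (fun v => f (t *: v + x) * phi (t ^+ 2) (t *: v + x - x))).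
      apply: (@comp_affine_continuous _ _ (fun y => f y * phi (t ^+ 2) (y - x))).
      by apply: mulf_continuous => //; exact: phiB_continuous.
    * by move=> u _; rewrite lee_fin mulr_ge0 ?phi_ge0.
    * by rewrite lee_fin exprn_ge0// ltW.
  + by apply: mulf_continuous => //; exact: phiB_continuous.
  + by move=> v; rewrite mulr_ge0 ?phi_ge0.
- by move=> v; rewrite lee_fin mulr_ge0 ?phi_ge0.
apply: (@measurable_toV_compE _ _ (fun v => f (t *: v + x) * phi 1 v)).
apply: mulf_continuous; [exact: comp_affine_continuous|exact: phi_continuous].
Qed.

Lemma sqnorm_shift n (z : 'rV[R]_n) (r : R) (i : 'I_n) :
  sqnorm (z - r *: ebasis R i) = sqnorm z - 2 * r * z 0 i + r ^+ 2.
Proof.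
rewrite /sqnorm (bigD1 i)//= [in RHS](bigD1 i)//= !mxE !eqxx/=.
rewrite (eq_bigr (fun j => z 0 j ^+ 2)) => [|j /negbTE ji]; first ring.
by rewrite !mxE eqxx ji/= mulr0 subr0.
Qed.

Lemma coord_le_sqnorm n (z : 'rV[R]_n) (i : 'I_n) : z 0 i ^+ 2 <= sqnorm z.
Proof.
by rewrite /sqnorm (bigD1 i)//= lerDl sumr_ge0// => j _; exact: sqr_ge0.
Qed.

(** Doubling the variance frees a factor [e^(-p/(4s))] with [p = |w|^2], and [1 + p <= (1 + 4s)(1 +
    p/(4s)) <= (1 + 4s) e^(p/(4s))]. *)
Lemma phi_moment_bound n (s : R) : 0 < s -> exists2 C, 0 <= C &
  forall w : 'rV[R]_n, (1 + sqnorm w) * phi s w <= C * phi (2 * s) w.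
Proof.
move=> s0; pose c (s : R) := (2 * pi * s) `^ (- n%:R / 2).
have c0 r : 0 < r -> 0 < c r by move=> r0; rewrite powR_gt0 ?mulr_gt0 ?pi_gt0.
have s20 : 0 < 2 * s by rewrite mulr_gt0.
exists (c s * (1 + 4 * s) / c (2 * s)).
  by rewrite !mulr_ge0 ?invr_ge0 ?(ltW (c0 _ _))// addr_ge0// mulr_ge0// ltW.
move=> w; rewrite /phi -/(c s) -/(c (2 * s)).
rewrite (mulrA (_ / _)) divfK ?gt_eqF ?c0//.
rewrite mulrCA -mulrA ler_pM2l ?c0//.
set p := sqnorm w; have p0 : 0 <= p by exact: sqnorm_ge0.
have -> : - p / (2 * s) = - p / (2 * (2 * s)) + - (p / (4 * s)).
  by field; rewrite gt_eqF.
rewrite expRD mulrCA (mulrC _ (expR (- p / _))) ler_pM2l ?expR_gt0//.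
rewrite expRN ler_pdivrMr ?expR_gt0//.
apply: (@le_trans _ _ ((1 + 4 * s) * (1 + p / (4 * s)))); last first.
  by rewrite ler_wpM2l ?expR_ge1Dx// addr_ge0// mulr_ge0// ltW.
have -> : (1 + 4 * s) * (1 + p / (4 * s)) = 1 + p + (4 * s + p / (4 * s)).
  by field; rewrite gt_eqF.
by rewrite lerDl addr_ge0 ?divr_ge0// mulr_ge0// ltW.
Qed.

(** For |r| < 1 one has [|z - r e_i|^2 >= |z|^2 / 2 - 1], by expanding [(z_i - 2 r)^2 >= 0]. *)
Lemma phi_shift_bound n (s : R) : 0 < s -> exists2 C, 0 <= C &
  forall (z : 'rV[R]_n) (r : R) i, -1 < r < 1 -> phi s (z - r *: ebasis R i) <= C * phi (2 * s) z.
Proof.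
move=> s0; pose c (s : R) := (2 * pi * s) `^ (- n%:R / 2).
have c0 r : 0 < r -> 0 < c r by move=> r0; rewrite powR_gt0 ?mulr_gt0 ?pi_gt0.
have s20 : 0 < 2 * s by rewrite mulr_gt0.
exists (c s * expR ((2 * s)^-1) / c (2 * s)).
  by rewrite !mulr_ge0 ?invr_ge0 ?(ltW (c0 _ _))// expR_ge0.
move=> z r i /andP[r1 r2]; rewrite /phi -/(c s) -/(c (2 * s)).
rewrite (mulrA (_ / _)) divfK ?gt_eqF ?c0// -mulrA ler_pM2l ?c0//.
rewrite -expRD ler_expR sqnorm_shift.
have -> : (2 * s)^-1 + - sqnorm z / (2 * (2 * s)) = (1 - sqnorm z / 2) / (2 * s).
  by field; rewrite gt_eqF.
rewrite ler_pM2r ?invr_gt0//.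
have r21 : r ^+ 2 <= 1 by nra.
have := coord_le_sqnorm z i; have := sqr_ge0 (z 0 i - 2 * r); nra.
Qed.

(** On this range the normalising factor is largest at [s/2] and the exponential at [2s]; C is the
    ratio of the two normalisations. *)
Lemma phi_time_bound n (s : R) : 0 < s -> exists2 C, 0 <= C &
  forall (z : 'rV[R]_n) r, s / 2 < r < 2 * s -> phi r z <= C * phi (2 * s) z.
Proof.
move=> s0; pose c (s : R) := (2 * pi * s) `^ (- n%:R / 2).
have c0 r : 0 < r -> 0 < c r by move=> r0; rewrite powR_gt0 ?mulr_gt0 ?pi_gt0.
have s20 : 0 < 2 * s by rewrite mulr_gt0.
have s2 : 0 < s / 2 by rewrite divr_gt0.
exists (c (s / 2) / c (2 * s)).
  by rewrite !mulr_ge0 ?invr_ge0 ?(ltW (c0 _ _)).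
move=> z r /andP[r1 r2]; have r0 : 0 < r by exact: lt_trans r1.
rewrite /phi -/(c r) -/(c (2 * s)).
rewrite (mulrA (_ / _)) divfK ?gt_eqF ?c0//.
apply: ler_pM; [exact: ltW (c0 _ r0)|exact: expR_ge0| |].
  rewrite /c mulNr !powRN lef_pV2 ?posrE ?powR_gt0 ?mulr_gt0 ?pi_gt0//.
  rewrite ge0_ler_powR ?nnegrE ?divr_ge0 ?mulr_ge0 ?pi_ge0 ?(ltW r0)//; first lra.
  by rewrite ler_pM2l ?mulr_gt0 ?pi_gt0// ltW.
rewrite ler_expR !mulNr lerN2 ler_wpM2l ?sqnorm_ge0// lef_pV2 ?posrE ?mulr_gt0//.
lra.
Qed.

Lemma is_derive_dirP (n : nat) (F : 'rV[R]_n -> R) (x v : 'rV[R]_n) (d : R) :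
  is_derive x v F d <-> is_derive (0 : R) 1 (fun r : R => F (r *: v + x)) d.
Proof.
have E : 'D_v F x = 'D_1 (fun r : R => F (r *: v + x)) 0.
  apply: (congr1 (fun g : R -> R => lim (g @ 0^'))); apply/funext => h /=.
  by rewrite scale0r add0r addr0 [h *: 1]mulr1.
split=> -[H1 H2].
  by apply: DeriveDef; [exact: (proj1 (derivable1P F x v))|rewrite -E].
by apply: DeriveDef; [exact: (proj2 (derivable1P F x v))|rewrite E].
Qed.

Lemma is_derive_phi_time n (z : 'rV[R]_n) (s : R) : 0 < s ->
  is_derive s 1 (fun r => phi r z)
    (phi s z * (sqnorm z / (2 * s ^+ 2) - n%:R / (2 * s))).
Proof.
move=> s0; pose p : R := - n%:R / 2; pose c : R := 2 * pi.
have c0 : 0 < c by rewrite mulr_gt0 ?pi_gt0.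
have cs0 : 0 < c * s by rewrite mulr_gt0.
have d1 : is_derive s 1 (fun r : R => c * r) c.
  have := @is_deriveZ R R R id c s 1 1 (is_derive_id _ _).
  by rewrite /GRing.scale/= mulr1.
have d2 := is_derive1_comp (is_derive1_powR p cs0) d1.
have d3 : is_derive s 1 (fun r : R => - sqnorm z / (2 * r)) (sqnorm z / (2 * s ^+ 2)).
  have sn0 : s != 0 by rewrite gt_eqF.
  have := @is_deriveZ R R R (fun r => r^-1) (- sqnorm z / 2) s 1 _
    (is_deriveV sn0 (is_derive_id _ _)).
  rewrite /GRing.scale/= => H.
  have -> : (fun r : R => - sqnorm z / (2 * r)) = (fun r => (- sqnorm z / 2) * r^-1).
    by apply/funext => r; rewrite invfM mulrA.
  by apply: is_derive_eq; field.
have d4 := is_derive1_comp (is_derive_expR _) d3.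
have := is_deriveM d2 d4; rewrite /GRing.scale/= => H.
apply: is_derive_eq.
rewrite /phi -/c -/p powRB ?powRr1 ?(ltW cs0)//; last by rewrite (gt_eqF cs0) implybT.
by rewrite /p; field; rewrite !gt_eqF.
Qed.

Lemma is_derive_phi_space n (z : 'rV[R]_n) (s r : R) (i : 'I_n) : 0 < s ->
  is_derive r 1 (fun r => phi s (z - r *: ebasis R i))
    (phi s (z - r *: ebasis R i) * ((z - r *: ebasis R i) 0 i / s)).
Proof.
move=> s0; pose c : R := (2 * pi * s) `^ (- n%:R / 2).
have d1 : is_derive r 1 (fun r : R => - sqnorm (z - r *: ebasis R i) / (2 * s))
    ((z 0 i - r) / s).
  rewrite (_ : (fun r => _) = horner
    (((2 * s)^-1)%:P * ((- sqnorm z)%:P + (2 * z 0 i) *: 'X - 'X^2))); last first.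
    by apply/funext => t; rewrite sqnorm_shift !hornerE; ring.
  have := is_derive_poly (((2 * s)^-1)%:P * ((- sqnorm z)%:P + (2 * z 0 i) *: 'X - 'X^2)) r.
  set p := (X in horner X) => H; apply: is_derive_eq.
  rewrite /p derivM derivC derivB derivD derivC derivZ derivX derivXn !hornerE/=.
  by field; rewrite gt_eqF.
have d2 := is_derive1_comp (is_derive_expR _) d1.
have := @is_deriveZ R R R _ c r 1 _ d2; rewrite /GRing.scale/= => H.
apply: is_derive_eq; rewrite /phi !mxE !eqxx/= mulr1 -/c; ring.
Qed.

(** Required for all variances, because a derivative of the kernel is dominated only by a Gaussian
    of larger variance. *)
Definition gauss_integrable n (f : 'rV[R]_n -> R) : Prop :=
  forall (s : R) x, 0 < s -> (intV (fun y => (f y * phi s (y - x))%:E) < +oo)%E.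

Definition heat n (f : 'rV[R]_n -> R) (s : R) (x : 'rV[R]_n) : R :=
  fine (intV (fun y => (f y * phi s (y - x))%:E)).

Definition kint n (f k : 'rV[R]_n -> R) : R :=
  \int[ms_mu (euclid R n)]_t (f (toV t) * k (toV t)).

Section HeatTheory.
Variables (n : nat) (f : 'rV[R]_n -> R).
Hypothesis cf : continuous f.
Hypothesis f0 : forall v, 0 <= f v.
Hypothesis fI : gauss_integrable f.
Local Notation m := (ms_mu (euclid R n)).

Lemma continuous_mul_phi (s : R) (x : 'rV[R]_n) :
  continuous (fun y : 'rV[R]_n => f y * phi s (y - x)).
Proof.
by apply: mulf_continuous => //; exact: phiB_continuous.
Qed.

Lemma integrable_phi (s : R) (x : 'rV[R]_n) : 0 < s ->
  m.-integrable setT (fun t => (f (toV t) * phi s (toV t - x))%:E).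
Proof.
move=> s0; apply/integrableP; split.
  exact: (measurable_toV_compE (@continuous_mul_phi s x)).
rewrite (eq_integral (fun t => (f (toV t) * phi s (toV t - x))%:E)).
  exact: fI.
by move=> t _; rewrite gee0_abs// lee_fin mulr_ge0 ?phi_ge0.
Qed.

Lemma heatE (s : R) (x : 'rV[R]_n) : 0 < s ->
  intV (fun y => (f y * phi s (y - x))%:E) = (heat f s x)%:E.
Proof.
move=> s0; rewrite /heat fineK// ge0_fin_numE ?fI//.
by apply: integral_ge0 => t _; rewrite lee_fin mulr_ge0 ?phi_ge0.
Qed.

Lemma integrable_kernel (k : 'rV[R]_n -> R) (C S : R) (x : 'rV[R]_n) :
  0 < S -> continuous k -> (forall y, `|k y| <= C * phi S (y - x)) ->
  m.-integrable setT (fun t => (f (toV t) * k (toV t))%:E).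
Proof.
move=> S0 ck kC.
have iG := integrableZl measurableT C (integrable_phi x S0).
apply: (le_integrable _ _ _ iG) => //.
  apply: (@measurable_toV_compE _ _ (fun y => f y * k y)).
  exact: mulf_continuous.
move=> t _; rewrite -EFinM !abse_EFin lee_fin (mulrCA C) [leLHS]normrM [leRHS]normrM.
by rewrite (ger0_norm (f0 _)) ler_wpM2l//; exact: le_trans (kC _) (ler_norm _).
Qed.

(** Dominated differentiation: one multiple of [phi S] bounds the kernel and its derivative
    uniformly in the parameter, and f times that Gaussian is integrable. *)
Lemma is_derive_kernel (K dK : R -> 'rV[R]_n -> R) (a u v C S : R) (x : 'rV[R]_n) :
  u < a < v -> 0 < S ->
  (forall r, u < r < v -> continuous (K r)) ->
  (forall r y, u < r < v -> `|K r y| <= C * phi S (y - x)) ->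
  (forall r y, u < r < v -> is_derive r 1 (K^~ y) (dK r y)) ->
  (forall r y, u < r < v -> `|dK r y| <= C * phi S (y - x)) ->
  is_derive a 1 (fun r => kint f (K r)) (kint f (dK a)).
Proof.
move=> uav S0 cK KC KdK dKC.
have C0 : 0 <= C * phi S (0 - x).
  by apply: le_trans (KC a 0 uav); exact: normr_ge0.
have C0' : 0 <= C by move: C0; rewrite pmulr_lge0// phi_gt0.
pose ff (r : R) (t : ms_sort (euclid R n)) : R := f (toV t) * K r (toV t).
pose G (t : ms_sort (euclid R n)) : R := C * (f (toV t) * phi S (toV t - x)).
have Ia : `]u, v[%classic a by rewrite /= in_itv.
have dff r t : `]u, v[%classic r -> is_derive r 1 (ff^~ t) (f (toV t) * dK r (toV t)).
  rewrite /= in_itv/= => ruv; have H := KdK r (toV t) ruv.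
  exact: is_deriveZ.
have iff r : `]u, v[%classic r -> m.-integrable setT (EFin \o ff r).
  rewrite /= in_itv/= => ruv.
  by apply: (@integrable_kernel (K r) C S x) => // [|y]; [exact: cK|exact: KC].
have df1 r t : `]u, v[%classic r -> [set: ms_sort (euclid R n)] t -> derivable (ff^~ t) r 1.
  by move=> ruv _; have H := dff r t ruv; exact: ex_derive.
have G0 t : 0 <= G t by rewrite mulr_ge0// mulr_ge0// phi_ge0.
have iG : m.-integrable setT (EFin \o G).
  exact: (integrableZl measurableT C (integrable_phi x S0)).
have Gub r t : `]u, v[%classic r -> [set: ms_sort (euclid R n)] t ->
    `|partial1of2 ff r t| <= G t.
  move=> ruv _; rewrite partial1of2E; have H := dff r t ruv; rewrite derive_val.
  rewrite normrM (ger0_norm (f0 _)) /G mulrCA ler_wpM2l//.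
  by apply: dKC; move: ruv; rewrite /= in_itv.
apply: DeriveDef.
  exact: (derivable_under_integral measurableT Ia iff df1 G0 iG Gub).
rewrite -derive1E.
rewrite [LHS](differentiation_under_integral measurableT Ia iff df1 G0 iG Gub).
apply: eq_Rintegral => t _; rewrite partial1of2E.
by have H := dff a t Ia; rewrite derive_val.
Qed.

(** The first space derivative of [heat], and in [heat2] the diagonal second one, with the
    derivative already on the kernel; the sign is positive since the kernel depends on y - x. *)
Definition heat1 (s : R) (i : 'I_n) (x : 'rV[R]_n) : R :=
  kint f (fun y => phi s (y - x) * ((y - x) 0 i / s)).

Definition heat2 (s : R) (i : 'I_n) (x : 'rV[R]_n) : R :=
  kint f (fun y => phi s (y - x) * (((y - x) 0 i) ^+ 2 / s ^+ 2 - s^-1)).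

(** The moment and the shift each cost a doubling of the variance, hence [4 * s]. *)
Lemma space_kernel_bound (s : R) (x : 'rV[R]_n) (i : 'I_n) : 0 < s ->
  exists2 C, 0 <= C & forall r y, -1 < r < 1 ->
    (1 + sqnorm (y - x - r *: ebasis R i)) * phi s (y - x - r *: ebasis R i) <=
    C * phi (4 * s) (y - x).
Proof.
move=> s0; have [C1 C10 H1] := phi_moment_bound n s0.
have s20 : 0 < 2 * s by rewrite mulr_gt0.
have [C2 C20 H2] := phi_shift_bound n s20.
exists (C1 * C2) => [|r y r1]; first by rewrite mulr_ge0.
apply: le_trans (H1 _) _; rewrite -mulrA ler_wpM2l//.
by have := H2 (y - x) r i r1; rewrite mulrA -natrM.
Qed.

(** Serves both space derivatives: k is [phi s] for the first and the kernel of [heat1] for the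
    second. *)
Lemma is_derive_kint_space (k dk : 'rV[R]_n -> R) (s A : R) (i : 'I_n) x :
  0 < s -> 0 <= A -> continuous k ->
  (forall w, `|k w| <= A * ((1 + sqnorm w) * phi s w)) ->
  (forall w, `|dk w| <= A * ((1 + sqnorm w) * phi s w)) ->
  (forall z (r : R), is_derive r 1 (fun r => k (z - r *: ebasis R i))
     (dk (z - r *: ebasis R i))) ->
  is_derive x (ebasis R i) (fun x => kint f (fun y => k (y - x)))
    (kint f (fun y => dk (y - x))).
Proof.
move=> s0 A0 ck kA dkA kdk; apply/is_derive_dirP.
have [C C0 HC] := @space_kernel_bound s x i s0.
have s40 : 0 < 4 * s by rewrite mulr_gt0.
have E (h : 'rV[R]_n -> R) r : (fun y => h (y - (r *: ebasis R i + x))) =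
    (fun y => h (y - x - r *: ebasis R i)).
  by apply/funext => y; rewrite opprD addrA addrAC.
have := @is_derive_kernel (fun r y => k (y - (r *: ebasis R i + x)))
  (fun r y => dk (y - (r *: ebasis R i + x))) 0 (-1) 1 (A * C) (4 * s) x.
rewrite scale0r add0r; apply => //.
- by rewrite ltrN10 ltr01.
- move=> r _ y; rewrite (E k).
  apply: (@continuous_comp _ _ _ (fun y : 'rV[R]_n => y - x - r *: ebasis R i) k); last exact: ck.
  have := @affine_continuous R n 1 (- x - r *: ebasis R i) y.
  by under eq_fun do rewrite scale1r addrA.
- move=> r y r1; have /= := congr1 (fun g => g y) (E k r) => ->.
  apply: le_trans (kA _) _; rewrite -mulrA ler_wpM2l//; exact: HC.
- move=> r y r1; have := kdk (y - x) r.
  have /= := congr1 (fun g => g y) (E dk r) => ->.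
  by under eq_fun do rewrite -addrA -opprD (addrC x).
- move=> r y r1; have /= := congr1 (fun g => g y) (E dk r) => ->.
  apply: le_trans (dkA _) _; rewrite -mulrA ler_wpM2l//; exact: HC.
Qed.

Lemma norm_coord_le (w : 'rV[R]_n) (i : 'I_n) : `|w 0 i| <= 1 + sqnorm w.
Proof.
have := coord_le_sqnorm w i; have := sqr_ge0 (`|w 0 i| - 1).
rewrite -(real_normK (num_real (w 0 i))); have := sqr_ge0 `|w 0 i|; nra.
Qed.

Lemma coord_continuousR (i : 'I_n) : continuous (fun w : 'rV[R]_n => w 0 i).
Proof. exact: coord_continuous. Qed.

Lemma is_derive_heat (s : R) (i : 'I_n) (x : 'rV[R]_n) : 0 < s ->
  is_derive x (ebasis R i) (heat f s) (heat1 s i x).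
Proof.
move=> s0; have si0 : 0 < s^-1 by rewrite invr_gt0.
apply: (@is_derive_kint_space (phi s) (fun w => phi s w * (w 0 i / s)) s (1 + s^-1)) => //.
- by rewrite addr_ge0// ltW.
- exact: phi_continuous.
- move=> w; rewrite ger0_norm ?phi_ge0// mulrA ler_peMl ?phi_ge0//.
  have := sqnorm_ge0 w; nra.
- move=> w; rewrite normrM (ger0_norm (phi_ge0 _ _)) mulrC mulrA.
  rewrite ler_wpM2r ?phi_ge0// normrM (ger0_norm (ltW si0)) mulrC.
  have := norm_coord_le w i; have := sqnorm_ge0 w; nra.
- by move=> z r; exact: is_derive_phi_space.
Qed.

Lemma is_derive_heat1 (s : R) (i : 'I_n) (x : 'rV[R]_n) : 0 < s ->
  is_derive x (ebasis R i) (heat1 s i) (heat2 s i x).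
Proof.
move=> s0; have si0 : 0 < s^-1 by rewrite invr_gt0.
apply: (@is_derive_kint_space (fun w => phi s w * (w 0 i / s))
  (fun w => phi s w * (w 0 i ^+ 2 / s ^+ 2 - s^-1)) s (s^-1 ^+ 2 + s^-1)) => //.
- by rewrite addr_ge0 ?sqr_ge0// ltW.
- apply: mulf_continuous; first exact: phi_continuous.
  apply: mulf_continuous; first exact: coord_continuousR.
  exact: cst_continuous.
- move=> w; rewrite normrM (ger0_norm (phi_ge0 _ _)) mulrC mulrA.
  rewrite ler_wpM2r ?phi_ge0// normrM (ger0_norm (ltW si0)) mulrC.
  have := norm_coord_le w i; have := sqnorm_ge0 w; have := sqr_ge0 s^-1; nra.
- move=> w; rewrite normrM (ger0_norm (phi_ge0 _ _)) mulrC mulrA.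
  rewrite ler_wpM2r ?phi_ge0// -exprVn.
  have := coord_le_sqnorm w i; have := sqr_ge0 s^-1; have := sqr_ge0 (w 0 i).
  by rewrite ler_norml => *; apply/andP; split; nra.
- move=> z r.
  have d1 := is_derive_phi_space z r i s0.
  have d2 : is_derive r 1 (fun r : R => (z - r *: ebasis R i) 0 i / s) (- s^-1).
    rewrite (_ : (fun r => _) = horner ((z 0 i / s)%:P - s^-1 *: 'X)); last first.
      by apply/funext => t; rewrite !mxE !eqxx/= !hornerE; ring.
    have := is_derive_poly ((z 0 i / s)%:P - s^-1 *: 'X) r.
    set p := (X in horner X) => H; apply: is_derive_eq.
    by rewrite /p derivB derivC derivZ derivX !hornerE/=; ring.
  have := is_deriveM d1 d2; rewrite /GRing.scale/= => H.
  by apply: is_derive_eq; field; rewrite gt_eqF.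
Qed.

(** The time derivative of the Gaussian kernel is half its Laplacian. Each second-derivative kernel
    is integrable against f, so the finite sum can leave the integral. *)
Lemma heat2_sum (s : R) (x : 'rV[R]_n) : 0 < s ->
  kint f (fun y => phi s (y - x) * (sqnorm (y - x) / (2 * s ^+ 2) - n%:R / (2 * s))) =
  2^-1 * \sum_(i < n) heat2 s i x.
Proof.
move=> s0.
have iK i : m.-integrable setT (fun t => (f (toV t) *
    (phi s (toV t - x) * (((toV t - x) 0 i) ^+ 2 / s ^+ 2 - s^-1)))%:E).
  have [C C0 HC] := phi_moment_bound n s0.
  have si0 : 0 < s^-1 by rewrite invr_gt0.
  apply: (@integrable_kernel (fun y => phi s (y - x) * (((y - x) 0 i) ^+ 2 / s ^+ 2 - s^-1))
    ((s^-1 ^+ 2 + s^-1) * C) (2 * s) x); first by rewrite mulr_gt0.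
    apply: mulf_continuous; first exact: phiB_continuous.
    apply: (@comp_sub_continuous R n (fun w => (w 0 i) ^+ 2 / s ^+ 2 - s^-1)) => w.
    apply: (@continuous_atD _ 'rV[R]_n); last exact: cst_continuous.
    apply: (@continuous_atM _ 'rV[R]_n); last exact: cst_continuous.
    exact: (continuous_atM (@coord_continuousR i w) (@coord_continuousR i w)).
  move=> y; set w := y - x; apply: (@le_trans _ _ ((s^-1 ^+ 2 + s^-1) * ((1 + sqnorm w) * phi s w))).
    rewrite normrM (ger0_norm (phi_ge0 _ _)) [leLHS]mulrC [leRHS]mulrA.
    rewrite ler_wpM2r ?phi_ge0// -exprVn.
    have := coord_le_sqnorm w i; have := sqr_ge0 s^-1; have := sqr_ge0 (w 0 i).
    by rewrite ler_norml => *; apply/andP; split; nra.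
  by rewrite -mulrA ler_wpM2l// addr_ge0 ?sqr_ge0// ltW.
have -> : \sum_(i < n) heat2 s i x = fine (\int[m]_t (\sum_(i < n) (f (toV t) *
    (phi s (toV t - x) * (((toV t - x) 0 i) ^+ 2 / s ^+ 2 - s^-1)))%:E))%E.
  rewrite integral_sum// -sum_fine// => i _; exact: integrable_fin_num.
rewrite /kint; under [in RHS]eq_integral do rewrite sumEFin.
rewrite [RHS](_ : _ = 2^-1 * \int[m]_t (\sum_(i < n) (f (toV t) *
    (phi s (toV t - x) * (((toV t - x) 0 i) ^+ 2 / s ^+ 2 - s^-1)))))//.
rewrite -RintegralZl//; last first.
  rewrite /comp; under eq_fun do rewrite -sumEFin; exact: integrable_sum.
apply: eq_Rintegral => t _; rewrite -!mulr_sumr.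
have -> : \sum_(i < n) ((toV t - x) 0 i ^+ 2 / s ^+ 2 - s^-1) =
    sqnorm (toV t - x) / s ^+ 2 - n%:R / s.
  by rewrite sumrB -mulr_suml sumr_const card_ord -[_ *+ n]mulr_natl.
rewrite [RHS]mulrCA; congr (_ * _); rewrite [RHS]mulrCA; congr (_ * _).
by field; rewrite gt_eqF.
Qed.

Lemma is_derive_heat_time (s : R) (x : 'rV[R]_n) : 0 < s ->
  is_derive s 1 (fun r => heat f r x) (2^-1 * \sum_(i < n) heat2 s i x).
Proof.
move=> s0; rewrite -heat2_sum//.
have s20 : 0 < 2 * s by rewrite mulr_gt0.
have [C1 C10 H1] := phi_time_bound n s0.
have [C2 C20 H2] := phi_moment_bound n s20.
pose A := 2 / s ^+ 2 + n%:R / s.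
have A0 : 0 <= A by rewrite addr_ge0// divr_ge0// ?sqr_ge0// ltW.
have HH (z : 'rV[R]_n) (r : R) : s / 2 < r < 2 * s ->
    (1 + sqnorm z) * phi r z <= C1 * C2 * phi (4 * s) z.
  move=> rs; apply: (@le_trans _ _ (C1 * ((1 + sqnorm z) * phi (2 * s) z))).
    by rewrite [leRHS]mulrCA ler_wpM2l ?H1// addr_ge0 ?sqnorm_ge0.
  rewrite -mulrA ler_wpM2l//; apply: le_trans (H2 z) _.
  by rewrite mulrA -natrM.
apply: (@is_derive_kernel (fun r y => phi r (y - x))
  (fun r y => phi r (y - x) * (sqnorm (y - x) / (2 * r ^+ 2) - n%:R / (2 * r)))
  s (s / 2) (2 * s) ((1 + A) * (C1 * C2)) (4 * s) x).
- by apply/andP; split; lra.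
- by rewrite mulr_gt0.
- by move=> r _; exact: phiB_continuous.
- move=> r y rs; rewrite ger0_norm ?phi_ge0//.
  rewrite -[leRHS]mulrA; apply: (@le_trans _ _ ((1 + A) * ((1 + sqnorm (y - x)) * phi r (y - x)))).
    rewrite mulrA ler_peMl ?phi_ge0//; have := sqnorm_ge0 (y - x); nra.
  by rewrite ler_wpM2l ?HH// addr_ge0.
- move=> r y /andP[rs _]; apply: is_derive_phi_time.
  by apply: lt_trans rs; rewrite divr_gt0.
- move=> r y rs; have /andP[r1 _] := rs.
  have r0 : 0 < r by apply: lt_trans r1; rewrite divr_gt0.
  rewrite -[leRHS]mulrA; apply: (@le_trans _ _ ((1 + A) * ((1 + sqnorm (y - x)) * phi r (y - x)))).
    rewrite normrM (ger0_norm (phi_ge0 _ _)) [leLHS]mulrC [leRHS]mulrA ler_wpM2r ?phi_ge0//.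
    set p := sqnorm _; have p0 : 0 <= p by exact: sqnorm_ge0.
    have b1 : (2 * r ^+ 2)^-1 <= 2 / s ^+ 2.
      rewrite -[leRHS]invrK lef_pV2 ?posrE ?invr_gt0 ?divr_gt0 ?mulr_gt0 ?exprn_gt0//.
      by rewrite invf_div ler_pdivrMr//; nra.
    have b2 : n%:R / (2 * r) <= n%:R / s.
      rewrite ler_wpM2l// lef_pV2 ?posrE ?mulr_gt0//; lra.
    have b10 : 0 <= (2 * r ^+ 2)^-1 by rewrite invr_ge0 mulr_ge0// sqr_ge0.
    have b20 : 0 <= n%:R / (2 * r) by rewrite divr_ge0// mulr_ge0// ltW.
    by rewrite /A ler_norml; apply/andP; split; nra.
  by rewrite ler_wpM2l ?HH// addr_ge0.
Qed.

End HeatTheory.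
End Heat.

(** * Maximum principles *)

Section OneVariable.
Variable R : realType.

Lemma is_derive_gt0_right (F : R -> R) (a d : R) :
  is_derive a 1 F d -> 0 < d ->
  exists2 e : R, 0 < e & forall h : R, 0 < h < e -> F a < F (h + a).
Proof.
move=> [dF dFE] d0.
have cF : h^-1 * (F (h + a) - F a) @[h --> 0^'] --> d.
  have := dF; rewrite /derivable => /cvg_ex[l cl].
  have := cvg_lim (@Rhausdorff R) cl => El.
  have -> : d = l by rewrite -dFE -El.
  by under eq_fun => h do rewrite -[X in F (X + a)]mulr1.
have : \forall h \near 0^', 0 < h^-1 * (F (h + a) - F a).
  exact: (cvgr_gt d cF 0 d0).
move=> /nbhs_ballP[e /= e0 He].
exists e => // h /andP[h0 he].
have : 0 < h^-1 * (F (h + a) - F a).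
  apply: He; last by rewrite gt_eqF.
  by rewrite /ball/= sub0r normrN gtr0_norm.
by rewrite pmulr_rgt0 ?invr_gt0// subr_gt0.
Qed.

(** No continuity of the second derivative is required: dF vanishes at the maximum, so [dd > 0]
    would make dF positive just to the right of 0, and the mean value theorem would give F a larger
    value there. *)
Lemma second_derivative_max (F dF : R -> R) (dd : R) :
  (forall r : R, is_derive r 1 F (dF r)) -> is_derive (0 : R) 1 dF dd ->
  (exists2 e : R, 0 < e & forall r : R, `|r| < e -> F r <= F 0) -> dd <= 0.
Proof.
move=> dF1 dF2 [e e0 Fmax]; rewrite leNgt; apply/negP => dd0.
have dF0 : dF 0 = 0.
  have H : is_derive (0 : R) 1 F 0.
    apply: (@derive1_at_max _ F (- e) e 0).
    - by rewrite ge0_cp// ltW.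
    - by move=> t _; have Ht := dF1 t; exact: ex_derive.
    - by rewrite in_itv/= oppr_lt0 e0.
    - by move=> t; rewrite in_itv/= => te; apply: Fmax; rewrite ltr_norml.
  by have := dF1 0; move=> [_ <-]; case: H => _ ->.
have [e' e'0 He'] := is_derive_gt0_right dF2 dd0.
pose r := Num.min e e' / 2.
have m0 : 0 < Num.min e e' by rewrite lt_min e0.
have r0 : 0 < r by rewrite divr_gt0.
have re : r < e /\ r < e'.
  by have : r < Num.min e e' by [rewrite /r; lra]; rewrite lt_min => /andP.
have [c c0r E] : exists2 c, c \in `]0, r[ & F r - F 0 = dF c * (r - 0).
  apply: MVT => //.
  apply: derivable_within_continuous => x _.
  by have Hx := dF1 x; exact: ex_derive.
have : 0 < dF c.
  move: c0r; rewrite in_itv/= => /andP[c0 cr].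
  by rewrite -{1}dF0 -[c]addr0; apply: He'; rewrite c0 (lt_trans cr) ?re.2.
have := Fmax r; rewrite gtr0_norm// => /(_ re.1) Fr dc0.
have : 0 < dF c * (r - 0) by rewrite subr0 mulr_gt0.
by rewrite -E subr_gt0 ltNge Fr.
Qed.

End OneVariable.

(** * Second derivatives along a direction and powers of [1 + |x|^2] *)

Section D2.
Variables (R : realType) (n : nat).
Implicit Types (e x : 'rV[R]_n) (F G : 'rV[R]_n -> R).

(** Carries the two derivatives explicitly, so that powers, differences and multiples compose
    without separate derivability goals. *)
Definition D2 e F dF ddF :=
  forall x, is_derive x e F (dF x) /\ is_derive x e dF (ddF x).

Lemma is_derive_line e x F (d r : R) : is_derive (r *: e + x) e F d ->
  is_derive r 1 (fun t : R => F (t *: e + x)) d.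
Proof.
move/is_derive_dirP => H.
have d1 : is_derive r 1 (fun t : R => t - r) 1.
  have := is_deriveB (is_derive_id r (1 : R)) (is_derive_cst r r (1 : R)).
  by rewrite subr0.
have d2 : is_derive (r - r) 1 (fun h : R => F (h *: e + (r *: e + x))) d by rewrite subrr.
have := @is_derive1_comp R (fun h : R => F (h *: e + (r *: e + x)))
  (fun t => t - r) r d 1 d2 d1; rewrite mulr1.
rewrite (_ : _ \o _ = (fun t : R => F (t *: e + x)))//.
by apply/funext => t /=; rewrite addrA -scalerDl subrK.
Qed.

Lemma D2_max e x F dF ddF : D2 e F dF ddF ->
  (exists2 d : R, 0 < d & forall r : R, `|r| < d -> F (r *: e + x) <= F x) -> ddF x <= 0.
Proof.
move=> H [d d0 Fmax].
apply: (@second_derivative_max _ (fun r => F (r *: e + x)) (fun r => dF (r *: e + x))).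
- by move=> r; apply: is_derive_line; exact: (H _).1.
- by apply: is_derive_line; rewrite scale0r add0r; exact: (H _).2.
- by exists d => // r /Fmax; rewrite scale0r add0r.
Qed.

Lemma is_derive_powR e x F (d p : R) : 0 < F x -> is_derive x e F d ->
  is_derive x e (fun y => F y `^ p) (p * F x `^ (p - 1) * d).
Proof.
move=> F0 /is_derive_dirP H; apply/is_derive_dirP.
have F0' : 0 < F (0 *: e + x) by rewrite scale0r add0r.
have := is_derive1_comp (is_derive1_powR p F0') H.
by rewrite scale0r add0r.
Qed.

Lemma D2_powR e F dF ddF (p : R) : (forall x, 0 < F x) -> D2 e F dF ddF ->
  D2 e (fun x => F x `^ p) (fun x => p * F x `^ (p - 1) * dF x)
    (fun x => p * (p - 1) * F x `^ (p - 2) * dF x ^+ 2 + p * F x `^ (p - 1) * ddF x).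
Proof.
move=> F0 H x; have [d1 d2] := H x; split; first exact: is_derive_powR.
have d3 := is_derive_powR (p - 1) (F0 x) d1.
have := is_deriveM (@is_deriveZ _ _ _ _ p _ _ _ d3) d2; rewrite /GRing.scale/= => H'.
apply: is_derive_eq; rewrite (_ : p - 1 - 1 = p - 2); last ring.
by rewrite -[p *: _]/(p * _); ring.
Qed.

Lemma D2B e F dF ddF G dG ddG : D2 e F dF ddF -> D2 e G dG ddG ->
  D2 e (fun x => F x - G x) (fun x => dF x - dG x) (fun x => ddF x - ddG x).
Proof.
move=> HF HG x; have [? ?] := HF x; have [? ?] := HG x.
by split; exact: is_deriveB.
Qed.

Lemma D2Z (c : R) e F dF ddF : D2 e F dF ddF ->
  D2 e (fun x => c * F x) (fun x => c * dF x) (fun x => c * ddF x).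
Proof. by move=> HF x; have [? ?] := HF x; split; exact: is_deriveZ. Qed.

Lemma lap_D2 F dF ddF x : (forall i, D2 (ebasis R i) F (dF i) (ddF i)) ->
  lap F x = \sum_(i < n) ddF i x.
Proof.
move=> H; apply: eq_bigr => i _.
have -> : 'D_(ebasis R i) F = dF i.
  by apply/funext => y; case: (H i y) => -[].
by case: (H i x) => _ [].
Qed.

(** The square of the usual Japanese bracket; its real powers are smooth weights of polynomial
    growth or decay. *)
Definition bracket x : R := 1 + sqnorm x.

Lemma bracket_ge1 x : 1 <= bracket x.
Proof. by rewrite lerDl sqnorm_ge0. Qed.

Lemma bracket_gt0 x : 0 < bracket x.
Proof. exact: lt_le_trans (bracket_ge1 x). Qed.

Lemma D2_bracket i : D2 (ebasis R i) bracket (fun x => 2 * x 0 i) (fun=> 2).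
Proof.
move=> x; split; apply/is_derive_dirP.
  rewrite (_ : (fun r => _) = horner ((bracket x)%:P + (2 * x 0 i) *: 'X + 'X^2)); last first.
    apply/funext => r; have -> : r *: ebasis R i + x = x - (- r) *: ebasis R i.
      by rewrite scaleNr opprK addrC.
    by rewrite /bracket sqnorm_shift !hornerE/=; ring.
  have := is_derive_poly ((bracket x)%:P + (2 * x 0 i) *: 'X + 'X^2) 0.
  set p := (X in horner X) => H; apply: is_derive_eq.
  by rewrite /p !derivD derivC derivZ derivX derivXn !hornerE/=; ring.
rewrite (_ : (fun r => _) = horner ((2 * x 0 i)%:P + 2 *: 'X)); last first.
  by apply/funext => r; rewrite !mxE !eqxx/= !hornerE/=; ring.
have := is_derive_poly ((2 * x 0 i)%:P + 2 *: 'X) (0 : R).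
set p := (X in horner X) => H; apply: is_derive_eq.
by rewrite /p derivD derivC derivZ derivX !hornerE/=; ring.
Qed.

Definition d_bracket_powR (p : R) i x : R := p * bracket x `^ (p - 1) * (2 * x 0 i).

Definition dd_bracket_powR (p : R) (i : 'I_n) x : R :=
  p * (p - 1) * bracket x `^ (p - 2) * (2 * x 0 i) ^+ 2 + p * bracket x `^ (p - 1) * 2.

Lemma D2_bracket_powR (p : R) i :
  D2 (ebasis R i) (fun x => bracket x `^ p) (d_bracket_powR p i) (dd_bracket_powR p i).
Proof. exact: (D2_powR p bracket_gt0 (D2_bracket i)). Qed.

(** The Laplacian of [(1 + |x|^2)^p], used with [p = -n] for the elliptic lower bound and with the
    positive exponent of the barrier. *)
Lemma sum_dd_bracket_powR (p : R) x :
  \sum_(i < n) dd_bracket_powR p i x =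
  2 * p * bracket x `^ (p - 2) * (2 * (p - 1) * sqnorm x + n%:R * bracket x).
Proof.
have b0 := bracket_gt0 x.
have E : bracket x `^ (p - 2) = bracket x `^ (p - 1) / bracket x.
  have -> : p - 2 = p - 1 - 1 by ring.
  by rewrite powRB ?powRr1 ?(ltW b0)// (gt_eqF b0) implybT.
rewrite /dd_bracket_powR big_split/= sumr_const card_ord -mulr_sumr.
have -> : \sum_(i < n) (2 * x 0 i) ^+ 2 = 4 * sqnorm x.
  by rewrite /sqnorm mulr_sumr; apply: eq_bigr => i _; ring.
by rewrite E -[_ *+ n]mulr_natl; field; rewrite gt_eqF.
Qed.

End D2.

(** * Lower semicontinuous functions and their minima on compact sets *)

Section Semicontinuity.
Variable R : realType.

Definition lsc (T : topologicalType) (f : T -> R) :=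
  forall x c, c < f x -> \forall y \near x, c < f y.

(** Without a minimiser, every x in K has some y in K with [f y < f x], an inequality that persists
    near x. Along the filter generated by the sublevel sets, compactness then yields one i in K with
    f i below f on all of K, including at i. *)
Lemma lsc_min (T : topologicalType) (K : set T) (f : T -> R) :
  compact K -> K !=set0 -> lsc f ->
  exists2 x, K x & forall y, K y -> f x <= f y.
Proof.
move=> cK [x0 Kx0] lf; apply: contrapT => noMin.
have H x : K x -> exists2 y, K y & f y < f x.
  move=> Kx; apply: contrapT => nex; apply: noMin; exists x => // y Ky.
  by rewrite leNgt; apply/negP => yx; apply: nex; exists y.
pose F := filter_from K (fun z => [set y | K y /\ f y <= f z]).
have FF : ProperFilter F.
  apply: filter_from_proper; last by move=> z Kz; exists z; split.
  apply: filter_from_filter; first by exists x0.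
  move=> i j Ki Kj; have [ij|ji] := leP (f i) (f j).
    by exists i => // y [Ky yi]; split; split=> //; exact: le_trans ij.
  by exists j => // y [Ky yj]; split; split=> //; exact: le_trans (ltW ji).
move/compact_near_coveringP : cK => /(_ T F (fun i x' => f i < f x') _) [].
  move=> x Kx; have [y Ky yx] := H x Kx.
  exists ([set x' | f y < f x'], [set i | K i /\ f i <= f y]) => /=.
    by split; [exact: lf|exists y].
  by move=> [x' i] /= [yx' [_ iy]]; exact: le_lt_trans yx'.
move=> z Kz sub.
have [i [/= [Ki _] Pi]] : exists i, (K i /\ f i <= f z) /\ (K `<=` (fun x => f i < f x)).
  by exists z; split => //; exact: sub.
by have := Pi i Ki; rewrite ltxx.
Qed.

Lemma lscD (T : topologicalType) (f g : T -> R) : lsc f -> lsc g ->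
  lsc (fun x => f x + g x).
Proof.
move=> lf lg x c cfg; pose e := (f x + g x - c) / 2.
have e0 : 0 < e by rewrite divr_gt0// subr_gt0.
have h1 : f x - e < f x by rewrite ltrBlDr ltrDl.
have h2 : g x - e < g x by rewrite ltrBlDr ltrDl.
near=> y.
have fy : f x - e < f y by near: y; exact: lf.
have gy : g x - e < g y by near: y; exact: lg.
by move: fy gy; rewrite /e; lra.
Unshelve. all: by end_near. Qed.

Lemma continuous_lsc (T : topologicalType) (f : T -> R) : continuous f -> lsc f.
Proof. by move=> cf x c cfx; exact: (cvgr_gt (f x) (cf x) c cfx). Qed.

(** The map [t |-> - t^(-p)] is increasing and continuous on positive numbers. Hence [H^-a] is upper
    semicontinuous when H is lower semicontinuous, which is the direction in which maxima are
    attained. *)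
Lemma lsc_powRN (T : topologicalType) (f : T -> R) (p : R) :
  (forall x, 0 < f x) -> 0 < p -> lsc f -> lsc (fun x => - (f x `^ (- p))).
Proof.
move=> f0 p0 lf x c cx.
have cN : f x `^ (- p) < - c by rewrite ltrNr.
have c0 : 0 < - c by apply: le_lt_trans cN; exact: powR_ge0.
have [k k0 kE] : exists2 k, 0 < k & k `^ (- p) = - c.
  exists ((- c) `^ (- p^-1)); first exact: powR_gt0.
  by rewrite -powRrM mulrNN mulVf ?gt_eqF// powRr1// ltW.
have inj a b : 0 < a -> 0 < b -> (a `^ (- p) < b `^ (- p)) = (b < a).
  move=> a0 b0; rewrite !powRN ltf_pV2 ?posrE ?powR_gt0//.
  apply/idP/idP => [|ba]; last by apply: gt0_ltr_powR; rewrite ?nnegrE ?ltW.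
  by apply: contraTT; rewrite -!leNgt => ab; apply: ge0_ler_powR => //; rewrite ?nnegrE ltW.
have kfx : k < f x by rewrite -inj// kE.
near=> y.
rewrite ltrNr -kE inj//; near: y; exact: lf.
Unshelve. all: by end_near. Qed.

End Semicontinuity.

Section Box.
Variables (R : realType) (n : nat).

Definition box (r : R) : set 'rV[R]_n := [set x | forall i, `|x 0 i| <= r].

Lemma box_compact (r : R) : compact (box r).
Proof.
have -> : box r = [set x : 'rV[R]_n | forall i, `[- r, r]%classic (x 0 i)].
  by apply/seteqP; split => x /= H i; have := H i; rewrite ?in_itv/= ler_norml.
by apply: (@rV_compact R n (fun=> `[- r, r]%classic)) => i; exact: segment_compact.
Qed.

Lemma box_bracket (x : 'rV[R]_n) (r : R) : bracket x <= r -> box r x.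
Proof. by move=> xr i; exact: le_trans (norm_coord_le x i) xr. Qed.

Lemma bracket_ge_coord (x : 'rV[R]_n) (r : R) i : 0 <= r -> r <= `|x 0 i| -> r <= bracket x.
Proof. by move=> r0 rx; exact: le_trans rx (norm_coord_le x i). Qed.

Lemma box_line (x : 'rV[R]_n) (r : R) i : (forall j, `|x 0 j| < r) ->
  exists2 d : R, 0 < d & forall t : R, `|t| < d -> box r (t *: ebasis R i + x).
Proof.
move=> xr; exists (r - `|x 0 i|); first by rewrite subr_gt0.
move=> t tr j; rewrite !mxE eqxx/=; case: eqVneq => [->|_].
  rewrite mulr1; apply: le_trans (ler_normD _ _) _; move: tr; lra.
by rewrite mulr0 add0r ltW.
Qed.

End Box.

(** * Lower bounds for positive superharmonic functions *)

Section Elliptic.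
Variables (R : realType) (n : nat).

(** Compare h with [m (1 + |x|^2)^(-n)], whose Laplacian is positive for |x| > 1 and which is at
    most [m <= h] on the unit ball. A minimum of the difference below -e can lie neither in the unit
    ball nor far out, and anywhere between it contradicts the signs of the two Laplacians. *)
Lemma superharmonic_lower_bound (h : 'rV[R]_n -> R) (dh ddh : 'I_n -> 'rV[R]_n -> R) (m : R) :
  (0 < n)%N -> lsc h -> (forall x, 0 < h x) ->
  (forall i, D2 (ebasis R i) h (dh i) (ddh i)) ->
  (forall x, \sum_(i < n) ddh i x <= 0) -> 0 < m ->
  (forall x, box 1 x -> m <= h x) ->
  forall x, m * bracket x `^ (- n%:R) <= h x.
Proof.
move=> n0 lh h0 Dh lap_h m0 hm x1; apply/ler_addgt0Pr => e e0.
rewrite leNgt; apply/negP => neg.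
pose N : R := n%:R; pose k x := h x - m * bracket x `^ (- N).
have N1 : 1 <= N by rewrite /N ler1n.
have ble1 (x : 'rV[R]_n) : bracket x `^ (- N) <= (bracket x)^-1.
  rewrite powRN lef_pV2 ?posrE ?powR_gt0 ?bracket_gt0//.
  by rewrite -[leLHS]powRr1 ?ler_powR ?bracket_ge1// ltW ?bracket_gt0.
have cb : continuous (fun x : 'rV[R]_n => bracket x).
  by move=> y; apply: (@continuous_atD _ 'rV[R]_n); [exact: cst_continuous|exact: sqnorm_continuous].
have lk : lsc k.
  apply: lscD => // ; apply: continuous_lsc => y.
  apply: (@continuous_atN _ 'rV[R]_n).
  apply: (@continuous_atM _ 'rV[R]_n); first exact: cst_continuous.
  apply: (@continuous_at_comp _ 'rV[R]_n _ _ _ (fun b => b `^ (- N))); first exact: cb.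
  apply: differentiable_continuous; apply/derivable1_diffP.
  by have H := is_derive1_powR (- N) (bracket_gt0 y); exact: ex_derive.
(* Where the bracket reaches r, the comparison function is at most e, since it is bounded by
   [m / bracket x]; the last term puts x1 in the box. *)
pose r := 1 + m / e + bracket x1.
have me0 : 0 < m / e by rewrite divr_gt0.
have b10 := bracket_ge1 x1.
have [x0 Bx0 x0min] : exists2 x, box r x & forall y, box r y -> k x <= k y.
  apply: lsc_min => //; first exact: box_compact.
  by exists x1; apply: box_bracket; rewrite /r; lra.
have kx1 : k x1 < - e by rewrite /k; move: neg; rewrite /N; lra.
have kx0 : k x0 < - e.
  by apply: le_lt_trans kx1; apply: x0min; apply: box_bracket; rewrite /r; lra.
have inside j : `|x0 0 j| < r.
  rewrite ltNge; apply/negP => rx.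
  have rb : r <= bracket x0 by apply: bracket_ge_coord rx; rewrite /r; lra.
  have : m * bracket x0 `^ (- N) <= e.
    apply: (@le_trans _ _ (m * (bracket x0)^-1)); first by rewrite ler_pM2l// ble1.
    rewrite ler_pdivrMr ?bracket_gt0// -ler_pdivrMl// mulrC.
    by apply: le_trans rb; rewrite /r; lra.
  by have := h0 x0; move: kx0; rewrite /k; lra.
have sq1 : 1 < sqnorm x0.
  rewrite ltNge; apply/negP => sq.
  have : m <= h x0.
    apply: hm => i; have := coord_le_sqnorm x0 i; rewrite -real_normK ?num_real// => H.
    by rewrite leNgt; apply/negP => a1; nra.
  have : m * bracket x0 `^ (- N) <= m.
    rewrite ler_piMr ?(ltW m0)// (le_trans (ble1 _))// invf_le1 ?bracket_gt0//.
    exact: bracket_ge1.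
  by move: kx0; rewrite /k; lra.
have dd i : m * dd_bracket_powR (- N) i x0 - ddh i x0 <= 0.
  apply: (D2_max (D2B (D2Z m (D2_bracket_powR (- N) i)) (Dh i))).
  have [d d0 Hd] := box_line i inside.
  by exists d => // t /Hd /x0min; rewrite /k; lra.
have : \sum_(i < n) (m * dd_bracket_powR (- N) i x0 - ddh i x0) <= 0.
  by apply: sumr_le0 => i _; exact: dd.
rewrite sumrB -mulr_sumr sum_dd_bracket_powR -/N.
set P := bracket x0 `^ _; have P0 : 0 < P by rewrite powR_gt0 ?bracket_gt0.
have -> : 2 * - N * P * (2 * (- N - 1) * sqnorm x0 + N * bracket x0) =
    2 * N * P * ((N + 2) * sqnorm x0 - N) by rewrite /bracket; ring.
have Q0 : 0 < (N + 2) * sqnorm x0 - N by nra.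
have : 0 < m * (2 * N * P * ((N + 2) * sqnorm x0 - N)).
  by rewrite !mulr_gt0//; lra.
by have := lap_h x0; lra.
Qed.

End Elliptic.

(** * The maximum principle for the backward heat operator *)

Section Parabolic.
Variables (R : realType) (n : nat).

Lemma is_derive_right_max (F : R -> R) (s d e : R) : is_derive s 1 F d -> 0 < e ->
  (forall t, s <= t < s + e -> F t <= F s) -> d <= 0.
Proof.
move=> dF e0 Fmax; rewrite leNgt; apply/negP => d0.
have [e' e'0 He] := is_derive_gt0_right dF d0.
pose h := Num.min e e' / 2.
have m0 : 0 < Num.min e e' by rewrite lt_min e0.
have : h < Num.min e e' by rewrite /h; lra.
rewrite lt_min => /andP[he he'].
have h0 : 0 < h by rewrite divr_gt0.
have := He h; rewrite h0 he' => /(_ isT).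
by rewrite ltNge Fmax// addrC lerDl ltW//= ltrD2l.
Qed.

(* Backward in time: the data are given at the final time [S]. *)
Lemma parabolic_maximum_principle (v : R * 'rV[R]_n -> R) (s1 S r : R) :
  lsc (fun p => - v p) ->
  (forall s x, s1 <= s <= S -> r <= bracket x -> v (s, x) <= 0) ->
  (forall x, v (S, x) <= 0) ->
  (forall s, s1 <= s < S -> exists dv ddv : 'I_n -> 'rV[R]_n -> R,
    (forall i, D2 (ebasis R i) (fun x => v (s, x)) (dv i) (ddv i)) /\
    forall x, exists2 d, is_derive s 1 (fun s => v (s, x)) d &
      0 < d + 2^-1 * \sum_(i < n) ddv i x) ->
  forall s x, s1 <= s <= S -> v (s, x) <= 0.
Proof.
move=> lv vr vS vpde s' x' s'S; rewrite leNgt; apply/negP => v0.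
(* The box contains x', and a point with a coordinate of size at least r' has bracket at least r,
   where v is nonpositive by assumption. *)
pose r' := Num.max r (bracket x') + 1.
have r'0 : 0 <= r'.
  by rewrite /r' addr_ge0// le_max (ltW (bracket_gt0 x')) orbT.
have cK : compact (`[s1, S]%classic `*` @box R n r').
  by apply: compact_setX; [exact: segment_compact|exact: box_compact].
have inK : (`[s1, S]%classic `*` @box R n r') (s', x').
  split => /=; first by rewrite in_itv.
  apply: box_bracket; rewrite /r'.
  have : bracket x' <= Num.max r (bracket x') by rewrite le_max lexx orbT.
  lra.
have [[s0 x0] [/= s0S Bx0] vmin] := lsc_min cK (ex_intro _ _ inK) lv.
have vmax s x : s1 <= s <= S -> box r' x -> v (s, x) <= v (s0, x0).
  by move=> sS Bx; rewrite -lerN2; apply: vmin; split => //=; rewrite in_itv.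
have v00 : 0 < v (s0, x0) by apply: lt_le_trans v0 _; exact: vmax inK.2.
rewrite in_itv/= in s0S; have /andP[s10 s0le] := s0S.
have inside j : `|x0 0 j| < r'.
  rewrite ltNge; apply/negP => rx.
  have rb : r <= bracket x0.
    apply: le_trans (bracket_ge_coord r'0 rx); rewrite /r'.
    have : r <= Num.max r (bracket x') by rewrite le_max lexx.
    lra.
  by have := vr s0 x0 s0S rb; rewrite leNgt v00.
have s0lt : s0 < S.
  rewrite lt_neqAle s0le andbT; apply/eqP => E.
  by have := vS x0; rewrite -E leNgt v00.
have [|dv [ddv [Dv pde]]] := vpde s0; first by rewrite s10.
have [d ds] := pde x0.
(* The maximum may sit at the initial time s1, so only later times are compared; this already bounds
   the derivative above by 0. *)
have dle0 : d <= 0.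
  apply: (is_derive_right_max ds (_ : 0 < S - s0)); first by rewrite subr_gt0.
  move=> t /andP[st tS]; apply: vmax => //; apply/andP; split; [exact: le_trans st|].
  by move: tS; lra.
have : \sum_(i < n) ddv i x0 <= 0.
  apply: sumr_le0 => i _; apply: (D2_max (Dv i)).
  have [e e0 He] := box_line i inside.
  by exists e => // t /He; exact: vmax.
lra.
Qed.

End Parabolic.

(** * Comparison for negative powers of the heat flow *)

Section Flow.
Variables (R : realType) (n : nat) (f : 'rV[R]_n -> R).
Hypothesis cf : continuous f.
Hypothesis f0 : forall v, 0 <= f v.
Hypothesis ffin : forall (t : R) u, 0 <= t -> (EZ (fun z => f (t *: z + u)) < +oo)%E.

(* The heat semigroup, extended to time [0]. *)
Definition flow (p : R * 'rV[R]_n) : R :=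
  fine (EZ (fun z => f (Num.sqrt p.1 *: z + p.2))).

Lemma measurable_mul_phi (s : R) (x : 'rV[R]_n) :
  measurable_fun setT (fun t => (f (@toV R n t) * phi s (toV t - x))%:E).
Proof. exact: (measurable_toV_compE (@continuous_mul_phi _ _ _ cf s x)). Qed.

Lemma EZE (t : R) (x : 'rV[R]_n) : EZ (fun z => f (t *: z + x)) =
  intV (fun z => (f (t *: z + x) * phi 1 z)%:E).
Proof.
rewrite /EZ iintE//; first by move=> v; rewrite lee_fin mulr_ge0 ?phi_ge0.
apply: (@measurable_toV_compE _ _ (fun v => f (t *: v + x) * phi 1 v)).
by apply: mulf_continuous; [exact: comp_affine_continuous|exact: phi_continuous].
Qed.

Lemma EZ_ge0 (t : R) (x : 'rV[R]_n) : (0 <= EZ (fun z => f (t *: z + x)))%E.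
Proof. by rewrite EZE; apply: integral_ge0 => ? _; rewrite lee_fin mulr_ge0 ?phi_ge0. Qed.

Lemma flowE p : (flow p)%:E = EZ (fun z => f (Num.sqrt p.1 *: z + p.2)).
Proof. by rewrite fineK// ge0_fin_numE ?ffin ?sqrtr_ge0// EZ_ge0. Qed.

Lemma flow_heat (s : R) x : 0 < s -> flow (s, x) = heat f s x.
Proof.
move=> s0; have t0 : 0 < Num.sqrt s by rewrite sqrtr_gt0.
by rewrite /flow (EZ_phi x cf f0 t0) (sqr_sqrtr (ltW s0)).
Qed.

Lemma flow_gauss_integrable : gauss_integrable f.
Proof.
move=> s x s0; have t0 : 0 < Num.sqrt s by rewrite sqrtr_gt0.
by have := ffin x (ltW t0); rewrite (EZ_phi x cf f0 t0) (sqr_sqrtr (ltW s0)).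
Qed.

Lemma flow0 x : flow (0, x) = f x.
Proof.
rewrite /flow EZE/= sqrtr0.
rewrite (_ : (fun z => _) = (fun z => (f x * phi 1 (z - 0))%:E)).
  by rewrite intV_cphi.
by apply/funext => z; rewrite scale0r add0r subr0.
Qed.

(* Joint continuity would need domination; Fatou's lemma gives this half for free,
   and the maximum principle needs no more. *)
Lemma flow_lsc : lsc flow.
Proof.
move=> p c cp; apply: contrapT => nnear.
(* If [c < flow p] did not persist near p, a sequence tending to p would have flow at most c, and
   Fatou's lemma would give [flow p <= c]. *)
have /choice[q qP] : forall k : nat, exists q, ball p k.+1%:R^-1 q /\ flow q <= c.
  move=> k; apply: contrapT => nex; apply: nnear; apply/nbhs_ballP.
  exists k.+1%:R^-1 => /=; first by rewrite invr_gt0.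
  by move=> q pq /=; rewrite ltNge; apply/negP => qc; apply: nex; exists q.
have qp : q k @[k --> \oo] --> p.
  apply/cvg_ballP => e e0; near=> k; apply: (@le_ball _ _ _ k.+1%:R^-1); last exact: (qP k).1.
  by apply: ltW; near: k; exact: (near_infty_natSinv_lt (PosNum e0)).
have cvf z : (f (Num.sqrt (q k).1 *: z + (q k).2) * phi 1 z)%:E @[k --> \oo] -->
    (f (Num.sqrt p.1 *: z + p.2) * phi 1 z)%:E.
  apply: cvg_EFin; first exact: nearW.
  apply: cvgMr_tmp.
  have c1 : {for p, continuous (fun p : R * 'rV[R]_n => Num.sqrt p.1 *: z + p.2)}.
    apply: (@cvgD _ _ _ (nbhs p) _ (fun p : R * 'rV[R]_n => Num.sqrt p.1 *: z) snd);
      last exact: cvg_snd.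
    apply: (@cvgZr_tmp _ _ _ (nbhs p) _ (fun p : R * 'rV[R]_n => Num.sqrt p.1)).
    apply: (@continuous_comp _ _ _ fst Num.sqrt); first exact: cvg_fst.
    exact: sqrt_continuous.
  have c2 := continuous_comp c1 (@cf _).
  exact: (cvg_comp _ _ qp c2).
have : (EZ (fun z => f (Num.sqrt p.1 *: z + p.2)) <= c%:E)%E.
  rewrite EZE.
  pose F (k : nat) (t : ms_sort (euclid R n)) : \bar R :=
    (f (Num.sqrt (q k).1 *: toV t + (q k).2) * phi 1 (toV t))%:E.
  have -> : intV (fun z => (f (Num.sqrt p.1 *: z + p.2) * phi 1 z)%:E) =
      (\int[ms_mu (euclid R n)]_t limn_einf (F^~ t))%E.
    by apply: eq_integral => t _; rewrite (cvg_limn_einf_sup (cvf (toV t))).1.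
  apply: le_trans (fatou _ measurableT _ _) _.
  - move=> k; apply: (@measurable_toV_compE _ _
      (fun z => f (Num.sqrt (q k).1 *: z + (q k).2) * phi 1 z)).
    by apply: mulf_continuous; [exact: comp_affine_continuous|exact: phi_continuous].
  - by move=> k t _; rewrite lee_fin mulr_ge0 ?phi_ge0.
  rewrite limn_einf_lim; apply: lime_le; first exact: is_cvg_einfs.
  apply: nearW => k; apply: (@le_trans _ _ (EZ (fun z => f (Num.sqrt (q k).1 *: z + (q k).2)))).
    rewrite EZE; apply: ereal_inf_lbound; exists k => //=.
  by rewrite -flowE lee_fin; exact: (qP k).2.
by rewrite -flowE lee_fin leNgt cp.
Unshelve. all: by end_near. Qed.

(** A zero integral would make the integrand vanish almost everywhere; as it is positive everywhere,
    the whole space would be null, against the total mass 1 of the Gaussian. *)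
Lemma EZ_gt0 (t : R) (x : 'rV[R]_n) : (forall v, 0 < f v) ->
  (0 < EZ (fun z => f (t *: z + x)))%E.
Proof.
move=> fpos; rewrite lt_neqAle EZ_ge0 andbT; apply/eqP => /esym I0.
have mF : measurable_fun setT (fun u => (f (t *: @toV R n u + x) * phi 1 (toV u))%:E).
  apply: (@measurable_toV_compE _ _ (fun v => f (t *: v + x) * phi 1 v)).
  by apply: mulf_continuous; [exact: comp_affine_continuous|exact: phi_continuous].
rewrite EZE in I0.
have /ae_eq_integral_abs : (\int[ms_mu (euclid R n)]_u
    `|(f (t *: @toV R n u + x) * phi 1 (toV u))%:E| = 0)%E.
  rewrite -[RHS]I0; apply: eq_integral => u _.
  by rewrite gee0_abs// lee_fin mulr_ge0 ?phi_ge0.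
move=> /(_ measurableT mF) [N [mN N0 subN]].
have NT : N = setT.
  apply/seteqP; split => // u _; apply: subN => /= /(_ I) [] /eqP.
  by rewrite gt_eqF// mulr_gt0 ?phi_gt0.
have := @intV_phi R n 1 0 ltr01; rewrite /intV.
rewrite null_set_integral//; [|exact: measurable_phiB|by rewrite -NT].
by move=> /eqP; rewrite eq_sym onee_eq0.
Qed.

Lemma flow_gt0 p : (forall v, 0 < f v) -> 0 < flow p.
Proof. by move=> fpos; rewrite -lte_fin flowE EZ_gt0. Qed.

(** The upper estimate near time 0, which lower semicontinuity does not give. Close to w, f is below
    [f w + e]; at distance at least r the kernel at time s is at most [Q s] times the kernel at time
    1, so the tail contributes at most [Q s H1]. *)
Lemma heat_small_time (w : 'rV[R]_n) (c : R) : f w < c ->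
  exists2 d : R, 0 < d & forall s, 0 < s < d -> heat f s w < c.
Proof.
move=> fwc; pose e := (c - f w) / 2.
have fI := flow_gauss_integrable.
have e0 : 0 < e by rewrite divr_gt0// subr_gt0.
have /nbhs_ballP[r /= r0 fr] : \forall y \near w, f y < f w + e.
  by have := cvgr_lt (f w) (@cf w) (f w + e); rewrite ltrDl; exact.
(* The normalisation costs at most [s^(-n)] for s < 1, and [e^(-X/s) <= (N s / X)^N] with
   [N = n + 1] repays it with one factor s to spare. *)
pose N := n.+1; pose X := r ^+ 2 / 2.
have X0 : 0 < X by rewrite divr_gt0// exprn_gt0.
pose Q := (N%:R / X) ^+ N * expR X.
have Q0 : 0 <= Q by rewrite mulr_ge0 ?expR_ge0// exprn_ge0// divr_ge0// ltW.
have far s (z : 'rV[R]_n) : 0 < s < 1 -> r ^+ 2 <= sqnorm z ->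
    phi s z <= Q * s * phi 1 z.
  move=> /andP[s0 s1] zr; rewrite /phi.
  set pi2 := 2 * pi; have pi20 : 0 < pi2 by rewrite mulr_gt0 ?pi_gt0.
  rewrite (powRM _ (ltW pi20) (ltW s0)) mulr1 mulrCA -[leLHS]mulrA.
  rewrite ler_pM2l ?powR_gt0//.
  have -> : - sqnorm z / (2 * s) = - sqnorm z / (2 * 1) + - (sqnorm z / 2 * (s^-1 - 1)).
    by field; rewrite gt_eqF.
  rewrite expRD mulrCA [leRHS]mulrC ler_pM2l ?expR_gt0//.
  have si1 : 1 <= s^-1 by rewrite -invr1 lef_pV2 ?posrE// ltW.
  have b1 : expR (- (sqnorm z / 2 * (s^-1 - 1))) <= expR X * expR (- (X / s)).
    rewrite -expRD ler_expR; have : r ^+ 2 / 2 <= sqnorm z / 2 by rewrite ler_pM2r.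
    by rewrite -/X => H; nra.
  have b2 : s `^ (- n%:R / 2) <= s ^- n.
    have -> : - n%:R / 2 = -1 * (n%:R / 2) :> R by ring.
    rewrite powRrM powR_inv1 ?(ltW s0)// -exprVn -powR_mulrn ?invr_ge0 ?(ltW s0)//.
    by rewrite ler_powR// ler_pdivrMr// ler_peMr// ler1n.
  have b3 : expR (- (X / s)) <= (N%:R / X) ^+ N * s ^+ N.
    have N0 : N%:R != 0 :> R by rewrite pnatr_eq0.
    have q0 : 0 < N%:R / X * s by rewrite mulr_gt0// divr_gt0.
    rewrite expRN -exprMn -[leRHS]invrK lef_pV2 ?posrE ?expR_gt0 ?invr_gt0 ?exprn_gt0//.
    rewrite -exprVn (_ : X / s = N%:R * (X / s / N%:R)); last by rewrite [RHS]mulrC divfK.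
    rewrite expRM_natl lerXn2r ?nnegrE ?expR_ge0 ?invr_ge0 ?(ltW q0)//.
    apply: le_trans (expR_ge1Dx _).
    by rewrite invfM invf_div mulrAC lerDr.
  apply: (@le_trans _ _ (s ^- n * (expR X * ((N%:R / X) ^+ N * s ^+ N)))).
    apply: ler_pM; rewrite ?powR_ge0 ?expR_ge0//.
    by apply: le_trans b1 _; rewrite ler_pM2l ?expR_gt0.
  rewrite /Q (_ : s ^+ N = s * s ^+ n); last by rewrite exprS.
  have T0 : s ^+ n != 0 by rewrite expf_neq0// gt_eqF.
  rewrite le_eqVlt; apply/orP; left; apply/eqP.
  set T := s ^+ n in T0 *; set E := expR X; set A := _ ^+ N.
  by transitivity (T^-1 * T * (A * E * s)); [ring|rewrite mulVf// mul1r].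
pose H1 := heat f 1 w.
have H10 : 0 <= H1.
  by rewrite fine_ge0// integral_ge0// => t _; rewrite lee_fin mulr_ge0 ?phi_ge0.
exists (Num.min 1 (e / (Q * H1 + 1))).
  by rewrite lt_min ltr01 divr_gt0// ltr_wpDl// mulr_ge0.
move=> s /andP[s0]; rewrite lt_min => /andP[s1 sQ].
have le1 : (intV (fun y => (f y * phi s (y - w))%:E) <=
    intV (fun y => ((f w + e) * phi s (y - w))%:E + (Q * s)%:E * (f y * phi 1 (y - w))%:E))%E.
  apply: ge0_le_integral => //.
  - by move=> t _; rewrite lee_fin mulr_ge0 ?phi_ge0.
  - exact: measurable_mul_phi.
  - apply: emeasurable_funD.
      apply: (@measurable_toV_compE _ _ (fun y => (f w + e) * phi s (y - w))).
      by apply: mulf_continuous; [exact: cst_continuous|exact: phiB_continuous].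
    apply: measurable_funeM.
    exact: measurable_mul_phi.
  move=> t _; rewrite -EFinM -EFinD lee_fin; set y := toV t.
  have fwe0 : 0 <= f w + e by rewrite addr_ge0// ltW.
  have Qs0 : 0 <= Q * s by rewrite mulr_ge0// ltW.
  have [yr|] := pselect (ball w r y).
    rewrite -[leLHS]addr0 lerD//.
      by rewrite ler_wpM2r ?phi_ge0// ltW// fr.
    by rewrite mulr_ge0// mulr_ge0// phi_ge0.
  move=> yr; rewrite -[leLHS]add0r lerD//; first by rewrite mulr_ge0 ?phi_ge0.
  rewrite [leRHS]mulrCA ler_wpM2l//; apply: far; first by rewrite s0.
  rewrite leNgt; apply/negP => small; apply: yr; split => // i j.
  rewrite (ord1 i) /ball/= distrC -ltr_sqr ?nnegrE ?(ltW r0)// real_normK ?num_real//.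
  by apply: le_lt_trans small; have := coord_le_sqnorm (y - w) j; rewrite !mxE.
have fwe0 : 0 <= f w + e by rewrite addr_ge0// ltW.
have Qs0 : 0 <= Q * s by rewrite mulr_ge0// ltW.
move: le1; rewrite (heatE f0 fI _ s0) /intV ge0_integralD//; last 4 first.
- by move=> t _; rewrite lee_fin mulr_ge0 ?phi_ge0.
- apply: (@measurable_toV_compE _ _ (fun y => (f w + e) * phi s (y - w))).
  by apply: mulf_continuous; [exact: cst_continuous|exact: phiB_continuous].
- by move=> t _; rewrite -EFinM lee_fin mulr_ge0// mulr_ge0// phi_ge0.
- apply: measurable_funeM.
  exact: measurable_mul_phi.
rewrite ge0_integralZl//; last 2 first.
- exact: measurable_mul_phi.
- by move=> t _; rewrite lee_fin mulr_ge0 ?phi_ge0.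
rewrite -!/(intV _) -[X in (_ <= X + _)%E]/(intV (fun y => ((f w + e) * phi s (y - w))%:E)).
rewrite intV_cphi// -[X in (_ <= _ + _ * X)%E]/(intV (fun y => (f y * phi 1 (y - w))%:E)).
rewrite (heatE f0 fI _ ltr01) -EFinM -EFinD lee_fin -/H1 => le2.
apply: le_lt_trans le2 _.
have : Q * s * H1 < e.
  have d0 : 0 < Q * H1 + 1 by rewrite ltr_wpDl// mulr_ge0.
  by move: sQ; rewrite ltr_pdivlMr//; nra.
by rewrite /e; lra.
Qed.

End Flow.

(** * The comparison argument for [H^-a] *)

Section Comparison.
Variables (R : realType) (n : nat) (g : 'rV[R]_n -> R) (a S : R).
Hypothesis n0 : (0 < n)%N.
Hypothesis cg : continuous g.
Hypothesis gpos : forall v, 0 < g v.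
Hypothesis gfin : forall (t : R) u, 0 <= t -> (EZ (fun z => g (t *: z + u)) < +oo)%E.
Hypothesis a01 : 0 < a < 1.
Hypothesis S0 : 0 < S.
Let b := (1 - a) / 2.
Hypothesis cH : continuous (heat g S).
(** Up to the positive factor [b H^(b-2)], the left side is the Laplacian of [H^b] at time s. *)
Hypothesis superharmonic : forall (s : R) x, 0 < s <= S ->
  (b - 1) * (\sum_(i < n) heat1 g s i x ^+ 2) + heat g s x * (\sum_(i < n) heat2 g s i x) <= 0.

Let g0 v : 0 <= g v. Proof. exact: ltW. Qed.
Let gI : gauss_integrable g. Proof. exact: flow_gauss_integrable. Qed.
Let a0 : 0 < a. Proof. by case/andP: a01. Qed.
Let a1 : a < 1. Proof. by case/andP: a01. Qed.
Let b0 : 0 < b. Proof. by rewrite divr_gt0// subr_gt0. Qed.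

Lemma powRN_le (x y p : R) : 0 <= p -> 0 < x -> x <= y -> y `^ (- p) <= x `^ (- p).
Proof.
move=> p0 x0 xy; have y0 := lt_le_trans x0 xy.
rewrite !powRN lef_pV2 ?posrE ?powR_gt0//.
by apply: ge0_ler_powR => //; rewrite nnegrE ltW.
Qed.

Lemma heat_gt0 (s : R) x : 0 < s -> 0 < heat g s x.
Proof. by move=> s0; rewrite -flow_heat//; exact: flow_gt0. Qed.

Lemma D2_heat (f : 'rV[R]_n -> R) (s : R) i : continuous f -> (forall v, 0 <= f v) ->
  gauss_integrable f -> 0 < s -> D2 (ebasis R i) (heat f s) (heat1 f s i) (heat2 f s i).
Proof.
by move=> cf f0 fI s0 x; split; [exact: is_derive_heat|exact: is_derive_heat1].
Qed.

Lemma lsc_comp (T U : topologicalType) (f : U -> R) (h : T -> U) :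
  continuous h -> lsc f -> lsc (fun x => f (h x)).
Proof. by move=> ch lf x c cx; exact: (ch x _ (lf _ _ cx)). Qed.

Lemma lsc_powR (T : topologicalType) (f : T -> R) (p : R) :
  (forall x, 0 < f x) -> 0 < p -> lsc f -> lsc (fun x => f x `^ p).
Proof.
move=> f0 p0 lf x c cx; have [c0|c0] := ltP c 0.
  by apply: nearW => y; exact: lt_le_trans (powR_ge0 _ _).
have cE : (c `^ p^-1) `^ p = c by rewrite -powRrM mulVf ?gt_eqF// powRr1.
have kx : c `^ p^-1 < f x.
  rewrite ltNge; apply/negP => fk.
  have : f x `^ p <= (c `^ p^-1) `^ p.
    by apply: ge0_ler_powR => //; rewrite ?nnegrE ?powR_ge0// ltW.
  by rewrite cE leNgt cx.
near=> y; rewrite -cE; apply: gt0_ltr_powR => //; rewrite ?nnegrE ?powR_ge0 ?(ltW (f0 _))//.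
by near: y; exact: lf.
Unshelve. all: by end_near. Qed.

Lemma pair_continuous (T U : topologicalType) (s : T) : continuous (fun x : U => (s, x)).
Proof. by move=> x; apply: cvg_pair; [exact: cvg_cst|exact: cvg_id]. Qed.

Let p := a / b.
Let p0 : 0 < p. Proof. by rewrite divr_gt0. Qed.
(** One more than the growth exponent [n p] of [H^-a], so that any positive multiple of the barrier
    wins at infinity. *)
Let k := n%:R * p + 1.

(** [H^-a] is [(H^b)^(-p)], and [H^b] is superharmonic, so its lower bound turns into growth of
    degree [n p = k - 1]. The constant is uniform in s because the flow has a positive minimum on
    [0, S] times the unit box, time 0 included. *)
Lemma heat_growth : exists2 C : R, 0 < C & forall (s : R) x, 0 < s <= S ->
  heat g s x `^ (- a) <= C * bracket x `^ (k - 1).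
Proof.
have lf := flow_lsc cg g0 gfin.
have cK : compact (`[0, S]%classic `*` @box R n 1).
  by apply: compact_setX; [exact: segment_compact|exact: box_compact].
have inK : (`[0, S]%classic `*` @box R n 1) (0, 0).
  by split => /=; [rewrite in_itv/= lexx ltW|move=> i; rewrite mxE normr0].
have [[s1 x1] _ min1] := lsc_min cK (ex_intro _ _ inK) lf.
pose m0 := flow g (s1, x1); have m00 : 0 < m0 by exact: flow_gt0.
pose m := m0 `^ b; have mpos : 0 < m by rewrite powR_gt0.
exists (m `^ (- p)) => [|s x /andP[s0 sS]]; first by rewrite powR_gt0.
have low : m * bracket x `^ (- n%:R) <= heat g s x `^ b.
  apply: (superharmonic_lower_bound n0 (h := fun x => heat g s x `^ b)
    (dh := fun i x => b * heat g s x `^ (b - 1) * heat1 g s i x)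
    (ddh := fun i x => b * (b - 1) * heat g s x `^ (b - 2) * heat1 g s i x ^+ 2 +
      b * heat g s x `^ (b - 1) * heat2 g s i x)) => //.
  - apply: lsc_powR => //; first by move=> y; exact: heat_gt0.
    rewrite (_ : heat g s = fun y => flow g (s, y)); last first.
      by apply/funext => y; rewrite flow_heat.
    by apply: (@lsc_comp _ _ (flow g)) => //; exact: pair_continuous.
  - by move=> y; rewrite powR_gt0// heat_gt0.
  - move=> i; apply: D2_powR; first by move=> y; exact: heat_gt0.
    exact: D2_heat.
  - move=> y; have h0 := heat_gt0 y s0.
    have E : heat g s y `^ (b - 1) = heat g s y `^ (b - 2) * heat g s y.
      have -> : b - 1 = b - 2 + 1 by ring.
      by rewrite powRD ?powRr1 ?(ltW h0)// (gt_eqF h0) implybT.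
    rewrite big_split/= -!mulr_sumr E.
    have -> : forall A B P, b * (b - 1) * P * A + b * (P * heat g s y) * B =
      b * P * ((b - 1) * A + heat g s y * B) by move=> A B P; ring.
    apply: mulr_ge0_le0; first by rewrite mulr_ge0 ?powR_ge0// ltW.
    by apply: superharmonic; rewrite s0.
  - move=> y By; rewrite /m; apply: ge0_ler_powR; rewrite ?nnegrE ?(ltW b0) ?(ltW m00)//.
      by rewrite ltW// heat_gt0.
    by rewrite -flow_heat//; apply: min1; split => //=; rewrite in_itv/= ltW.
have -> : heat g s x `^ (- a) = (heat g s x `^ b) `^ (- p).
  by rewrite -powRrM mulrN /p mulrCA divff ?mulr1// gt_eqF.
have br0 := bracket_gt0 x.
have -> : m `^ (- p) * bracket x `^ (k - 1) = (m * bracket x `^ (- n%:R)) `^ (- p).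
  rewrite powRM ?(ltW mpos) ?powR_ge0// -powRrM mulrNN; congr (_ * _ `^ _).
  by rewrite /k addrK.
by apply: powRN_le; rewrite ?(ltW p0)// mulr_gt0// powR_gt0.
Qed.

(* The truncation makes the comparison function [P_(S - s) psi] bounded. *)
Let psi (K : R) x := Num.min (heat g S x `^ (- a)) K.

Let psi_continuous K : continuous (psi K).
Proof.
move=> x; apply: (@continuous_min _ _ (fun x => heat g S x `^ (- a)) (fun=> K)); last exact: cst_continuous.
apply: (@continuous_at_comp _ 'rV[R]_n _ _ _ (fun h => h `^ (- a))); first exact: cH.
apply: differentiable_continuous; apply/derivable1_diffP.
by have H := is_derive1_powR (- a) (heat_gt0 x S0); exact: ex_derive.
Qed.

Let psi_ge0 K x : 0 <= K -> 0 <= psi K x.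
Proof. by move=> K0; rewrite le_min powR_ge0. Qed.

Let psi_fin K (t : R) u : 0 <= K -> 0 <= t -> (EZ (fun z => psi K (t *: z + u)) < +oo)%E.
Proof.
move=> K0 t0; rewrite (EZE (@psi_continuous K) (fun v => psi_ge0 v K0)).
apply: (@le_lt_trans _ _ (intV (fun z => (K * phi 1 (z - 0))%:E))); last by rewrite intV_cphi// ltry.
apply: ge0_le_integral => //.
- by move=> x _; rewrite lee_fin mulr_ge0 ?phi_ge0// psi_ge0.
- apply: (@measurable_toV_compE _ _ (fun z => psi K (t *: z + u) * phi 1 z)).
  apply: mulf_continuous; last exact: phi_continuous.
  by apply: comp_affine_continuous; exact: psi_continuous.
- apply: (@measurable_toV_compE _ _ (fun z => K * phi 1 (z - 0))).
  by apply: mulf_continuous; [exact: cst_continuous|exact: phiB_continuous].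
by move=> x _; rewrite lee_fin subr0 ler_wpM2r ?phi_ge0// ge_min lexx orbT.
Qed.

(** Chosen so that [(1 + |x|^2)^k] has Laplacian at most L times itself. In the barrier the time
    derivative then contributes -L and half the Laplacian at most L/2, which leaves a strict
    inequality. *)
Let L := 2 * k * (2 * (k - 1) + n%:R).

Let k1 : 1 <= k. Proof. by rewrite lerDr mulr_ge0// ltW. Qed.

Let L0 : 0 < L.
Proof.
have n1 : 1 <= n%:R :> R by rewrite ler1n.
by rewrite /L !mulr_gt0//; have := k1; lra.
Qed.

Let barrier_lap x : \sum_(i < n) dd_bracket_powR k i x <= L * bracket x `^ k.
Proof.
rewrite sum_dd_bracket_powR; have B0 := bracket_gt0 x; have B1 := bracket_ge1 x.
have E : bracket x `^ k = bracket x `^ (k - 2) * bracket x * bracket x.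
  have {1}-> : k = k - 2 + 1 + 1 by ring.
  by rewrite !powRD ?powRr1 ?(ltW B0)// (gt_eqF B0) implybT.
rewrite E /L; set P := bracket x `^ _; have P0 : 0 <= P by exact: powR_ge0.
have S1 : sqnorm x <= bracket x by rewrite lerDr.
have k1' := k1; have nn : 0 <= n%:R :> R by [].
apply: (@le_trans _ _ (2 * k * P * ((2 * (k - 1) + n%:R) * bracket x))).
  apply: ler_wpM2l; first by rewrite mulr_ge0//; lra.
  nra.
rewrite (_ : 2 * k * (2 * (k - 1) + n%:R) * (P * bracket x * bracket x) =
  2 * k * P * ((2 * (k - 1) + n%:R) * bracket x) * bracket x); last ring.
rewrite ler_peMr// mulr_ge0//; first by rewrite mulr_ge0//; lra.
by rewrite mulr_ge0 ?(ltW B0)//; lra.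
Qed.

(** The maximum principle is applied from the positive time s itself, since the flow is
    differentiated only at positive times. The error is bounded with [e^(L S)], independent of s, so
    that s can later tend to 0. *)
Lemma heat_compare (e : R) : 0 < e -> exists2 K, 0 <= K &
  forall (s : R) w, 0 < s < S -> heat g s w `^ (- a) <=
    heat (psi K) (S - s) w + e * (expR (L * S) * bracket w `^ k).
Proof.
move=> e0; have [C C0 growth] := heat_growth.
(* Where the bracket is at least [C / e] the barrier alone dominates [H^-a]; where it is smaller,
   [H_S^-a] is at most K and the truncation changes nothing. *)
pose K := C * (C / e + 1) `^ (k - 1).
have K0 : 0 <= K by rewrite mulr_ge0 ?powR_ge0// ltW.
exists K => // s1 w /andP[s10 s1S].
have dom (s : R) x : 0 < s <= S -> C / e <= bracket x ->
    heat g s x `^ (- a) <= e * bracket x `^ k.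
  move=> sS Ce; apply: le_trans (growth _ _ sS) _.
  have B0 := bracket_gt0 x.
  have -> : bracket x `^ k = bracket x `^ (k - 1) * bracket x.
    have kE : k = k - 1 + 1 by ring.
    by rewrite {1}kE powRD ?powRr1 ?(ltW B0)// (gt_eqF B0) implybT.
  rewrite mulrCA (mulrC C) ler_wpM2l ?powR_ge0//.
  by rewrite mulrC -ler_pdivrMr.
have psi_bound x : heat g S x `^ (- a) <= psi K x + e * bracket x `^ k.
  have eB : 0 <= e * bracket x `^ k by rewrite mulr_ge0 ?powR_ge0// ltW.
  have SS : 0 < S <= S by rewrite S0 lexx.
  have [Ce|Ce] := leP (C / e) (bracket x).
    by apply: le_trans (dom S x SS Ce) _; rewrite lerDr psi_ge0.
  have hK : heat g S x `^ (- a) <= K.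
    apply: le_trans (growth S x SS) _; rewrite ler_pM2l//.
    apply: ge0_ler_powR; rewrite ?nnegrE.
    - by have := k1; lra.
    - by rewrite ltW// bracket_gt0.
    - by rewrite addr_ge0// divr_ge0// ltW.
    - by move: Ce; lra.
  by rewrite /psi min_l// lerDl.
have cpsi := @psi_continuous K.
have psi0 v := psi_ge0 v K0.
have psifin t u := @psi_fin K t u K0.
have psiI : gauss_integrable (psi K) by exact: flow_gauss_integrable.
(* [flow] instead of [heat], because at s = S the second term is taken at time 0 and must be psi. As
   [Num.sqrt] vanishes at negative arguments, [flow] is lower semicontinuous on all of [R * R^n]. *)
pose v (q : R * 'rV[R]_n) : R := flow g q `^ (- a) - flow (psi K) (S - q.1, q.2) -
  e * (expR (L * (S - q.1)) * bracket q.2 `^ k).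
have cfst : continuous (fst : R * 'rV[R]_n -> R) by move=> q; exact: cvg_fst.
have csnd : continuous (snd : R * 'rV[R]_n -> 'rV[R]_n) by move=> q; exact: cvg_snd.
have cSs : continuous (fun q : R * 'rV[R]_n => S - q.1).
  by move=> q; apply: (@cvgB _ _ _ (nbhs q)); [exact: cvg_cst|exact: cfst].
have vle : forall s x, s1 <= s <= S -> v (s, x) <= 0.
  apply: (@parabolic_maximum_principle R n v s1 S (C / e)).
  - rewrite (_ : (fun q => - v q) = fun q => - (flow g q `^ (- a)) +
        (flow (psi K) (S - q.1, q.2) + e * (expR (L * (S - q.1)) * bracket q.2 `^ k))); last first.
      by apply/funext => q; rewrite /v; ring.
    apply: lscD; first apply: lsc_powRN => //.
    + by move=> q; exact: flow_gt0.
    + exact: flow_lsc.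
    apply: lscD.
      apply: (@lsc_comp _ _ (flow (psi K)) (fun q : R * 'rV[R]_n => (S - q.1, q.2))).
        by move=> q; exact: (cvg_pair (cSs q) (csnd q)).
      exact: flow_lsc.
    apply: continuous_lsc => q; apply: (@continuous_atM _ (R * 'rV[R]_n)%type); first exact: continuous_at_cst.
    apply: (@continuous_atM _ (R * 'rV[R]_n)%type).
      apply: (@continuous_at_comp _ (R * 'rV[R]_n)%type _ (fun q : R * 'rV[R]_n => L * (S - q.1)) _ expR);
        last exact: continuous_expR.
      by apply: (@continuous_atM _ (R * 'rV[R]_n)%type); [exact: continuous_at_cst|exact: cSs].
    apply: (@continuous_at_comp _ (R * 'rV[R]_n)%type _ (fun q : R * 'rV[R]_n => bracket q.2) _ (fun y => y `^ k)).
      apply: (@continuous_atD _ (R * 'rV[R]_n)%type); first exact: continuous_at_cst.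
      apply: (@continuous_comp _ _ _ snd (@sqnorm R n)); first exact: csnd.
      exact: sqnorm_continuous.
    apply: differentiable_continuous; apply/derivable1_diffP.
    by have H := is_derive1_powR k (bracket_gt0 q.2); exact: ex_derive.
  - move=> s x /andP[s1s sS] Cx; rewrite /v/=.
    have s0 : 0 < s by exact: lt_le_trans s1s.
    rewrite flow_heat//; have := dom s x; rewrite s0 sS => /(_ isT Cx).
    have : 0 <= flow (psi K) (S - s, x).
      by rewrite -lee_fin flowE//; exact: EZ_ge0.
    have : e * bracket x `^ k <= e * (expR (L * (S - s)) * bracket x `^ k).
      rewrite ler_pM2l// ler_peMl ?powR_ge0// -expR0 ler_expR mulr_ge0 ?(ltW L0)//.
      by rewrite subr_ge0.
    lra.
  - move=> x; rewrite /v/= subrr mulr0 expR0 mul1r flow0// flow_heat//.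
    by have := psi_bound x; lra.
  - move=> s /andP[s1s sS]; have s0 : 0 < s by exact: lt_le_trans s1s.
    have Ss0 : 0 < S - s by rewrite subr_gt0.
    pose E := expR (L * (S - s)); have E0 : 0 < E by exact: expR_gt0.
    exists (fun i x => (- a) * heat g s x `^ (- a - 1) * heat1 g s i x -
        heat1 (psi K) (S - s) i x - e * (E * d_bracket_powR k i x)).
    exists (fun i x => ((- a) * (- a - 1) * heat g s x `^ (- a - 2) * heat1 g s i x ^+ 2 +
          (- a) * heat g s x `^ (- a - 1) * heat2 g s i x) -
        heat2 (psi K) (S - s) i x - e * (E * dd_bracket_powR k i x)).
    split => [i|x].
      rewrite (_ : (fun x => v (s, x)) = fun x => heat g s x `^ (- a) -
        heat (psi K) (S - s) x - e * (E * bracket x `^ k)); last first.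
        by apply/funext => x; rewrite /v/= !flow_heat.
      apply: D2B; last by do 2 apply: D2Z; exact: D2_bracket_powR.
      apply: D2B; last exact: D2_heat.
      apply: D2_powR; first by move=> y; exact: heat_gt0.
      exact: D2_heat.
    have h0 := heat_gt0 x s0.
    have d1 : is_derive s 1 (fun s => heat g s x `^ (- a))
        ((- a) * heat g s x `^ (- a - 1) * (2^-1 * \sum_(i < n) heat2 g s i x)).
      exact: (is_derive1_comp (is_derive1_powR (- a) h0) (is_derive_heat_time cg g0 gI x s0)).
    have dS : is_derive s 1 (fun s : R => S - s) (-1).
      have := is_deriveB (is_derive_cst S s (1 : R)) (is_derive_id s (1 : R)).
      by rewrite sub0r.
    have d2 : is_derive s 1 (fun s => heat (psi K) (S - s) x)
        ((2^-1 * \sum_(i < n) heat2 (psi K) (S - s) i x) * -1).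
      exact: (@is_derive1_comp R (fun r => heat (psi K) r x) (fun s => S - s) s _ _
        (is_derive_heat_time cpsi psi0 psiI x Ss0) dS).
    have d3 : is_derive s 1 (fun s => expR (L * (S - s))) (E * (L * -1)).
      have := @is_derive1_comp R expR (fun s => L * (S - s)) s E (L * -1) (is_derive_expR _).
      by apply; exact: is_deriveZ.
    have d4 : is_derive s 1 (fun s => e * (expR (L * (S - s)) * bracket x `^ k))
        (e * bracket x `^ k * (E * (L * -1))).
      rewrite (_ : (fun s => _) = fun s => (e * bracket x `^ k) * expR (L * (S - s))); last first.
        by apply/funext => r; ring.
      exact: is_deriveZ.
    eexists.
      apply: (@near_eq_is_derive _ _ _ (fun s => heat g s x `^ (- a) -
        heat (psi K) (S - s) x - e * (expR (L * (S - s)) * bracket x `^ k))).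
        near=> r; rewrite /v/= !flow_heat//; first by rewrite subr_gt0; near: r; exact: lt_nbhsl.
        by near: r; exact: lt_nbhsr.
    rewrite !sumrB big_split/= -!mulr_sumr.
    set A := \sum_(i < n) heat1 g s i x ^+ 2; set B := \sum_(i < n) heat2 g s i x.
    set D := \sum_(i < n) heat2 (psi K) _ i x; set V := \sum_(i < n) dd_bracket_powR k i x.
    have Vle : V <= L * bracket x `^ k by exact: barrier_lap.
    have AB : (b - 1) * A + heat g s x * B <= 0.
      by apply: superharmonic; rewrite s0 ltW.
    have HE : heat g s x `^ (- a - 1) = heat g s x `^ (- a - 2) * heat g s x.
      have -> : - a - 1 = - a - 2 + 1 by ring.
      by rewrite powRD ?powRr1 ?(ltW h0)// (gt_eqF h0) implybT.
    rewrite HE; set P := heat g s x `^ (- a - 2); have P0 : 0 <= P by exact: powR_ge0.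
    have bk0 : 0 < bracket x `^ k by rewrite powR_gt0// bracket_gt0.
    (* The two terms in D cancel, since psi evolves by the backward heat equation; the powers of H
       collect into the expression of [superharmonic] because [-(1 + a)/2 = b - 1]. *)
    have -> : forall h X, - a * (P * h) * (2^-1 * B) - 2^-1 * D * -1 - e * X * (E * (L * -1)) +
       2^-1 * (- a * (- a - 1) * P * A + - a * (P * h) * B - D - e * (E * V)) =
       - (a * P) * ((b - 1) * A + h * B) + e * E * (L * X - 2^-1 * V).
      by move=> h X; rewrite /b; field.
    apply: ltr_wpDl.
      by rewrite mulNr oppr_ge0; apply: mulr_ge0_le0 => //; rewrite mulr_ge0// ltW.
    rewrite mulr_gt0// ?mulr_gt0//.
    have : 0 < L * bracket x `^ k by rewrite mulr_gt0.
    lra.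
have := vle s1 w; rewrite lexx ltW// => /(_ isT); rewrite /v/= !flow_heat ?subr_gt0//.
have : e * (expR (L * (S - s1)) * bracket w `^ k) <= e * (expR (L * S) * bracket w `^ k).
  rewrite ler_pM2l// ler_wpM2r ?powR_ge0// ler_expR ler_pM2l//; lra.
lra.
Unshelve. all: by end_near. Qed.

(** [heat_compare] with s tending to 0, and then e to 0. Passing to the limit needs
    [heat_small_time] on the left and continuity of the flow of psi at the positive time S on the
    right; finally psi is at most [H_S^-a]. *)
Lemma heat_powRN_ge (w : 'rV[R]_n) :
  ((g w `^ (- a))%:E <= intV (fun y => (heat g S y `^ (- a) * phi S (y - w))%:E))%E.
Proof.
have step (e : R) : 0 < e -> exists2 K, 0 <= K &
    g w `^ (- a) <= heat (psi K) S w + e * (expR (L * S) * bracket w `^ k).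
  move=> e0; have [K K0 cmp] := heat_compare e0; exists K => //.
  set Z := e * _; rewrite leNgt; apply/negP => lt1.
  have cpsi := @psi_continuous K; have psi0 v := psi_ge0 v K0.
  have psifin t u := @psi_fin K t u K0.
  have psiI : gauss_integrable (psi K) by exact: flow_gauss_integrable.
  (* The midpoint of the gap to be refuted: for small s the left side of [heat_compare] exceeds c
     while the right side stays below it. *)
  pose c := (heat (psi K) S w + Z + g w `^ (- a)) / 2.
  have hc : heat (psi K) S w < c - Z by rewrite /c; lra.
  have cg' : c < g w `^ (- a) by rewrite /c; lra.
  have h0 : 0 <= heat (psi K) S w.
    by rewrite -flow_heat// -lee_fin flowE//; exact: EZ_ge0.
  have Z0 : 0 <= Z by rewrite mulr_ge0 ?(ltW e0)// mulr_ge0 ?expR_ge0 ?powR_ge0.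
  have c0 : 0 < c by rewrite /c; move: lt1; lra.
  have ai0 : 0 < a^-1 by rewrite invr_gt0.
  have cE : (c `^ (- a^-1)) `^ (- a) = c.
    by rewrite -powRrM mulrNN mulVf ?gt_eqF// powRr1// ltW.
  have gwc : g w < c `^ (- a^-1).
    rewrite ltNge; apply/negP => le1.
    have := powRN_le (ltW a0) (powR_gt0 _ c0) le1.
    by rewrite cE leNgt cg'.
  have [d d0 small] := heat_small_time cg g0 gfin gwc.
  have : \forall s \near S, heat (psi K) s w < c - Z.
    have H := is_derive_heat_time cpsi psi0 psiI w S0.
    have /differentiable_continuous cont : differentiable (fun s => heat (psi K) s w) S.
      by apply/derivable1_diffP; exact: ex_derive.
    by have := cvgr_lt _ cont _ hc; exact.
  move=> /nbhs_ballP[r /= r0 Hr].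
  pose s := Num.min (Num.min d r) S / 2.
  have M0 : 0 < Num.min (Num.min d r) S by rewrite !lt_min d0 r0.
  have sM : s < Num.min (Num.min d r) S by rewrite /s; lra.
  have s0 : 0 < s by rewrite divr_gt0.
  move: sM; rewrite !lt_min => /andP[/andP[sd sr] sS].
  have h1 : heat g s w < c `^ (- a^-1) by apply: small; rewrite s0.
  have h2 : heat (psi K) (S - s) w < c - Z.
    have E : S - (S - s) = s by ring.
    by apply: Hr; rewrite /ball/= E gtr0_norm.
  have h3 := cmp s w; rewrite s0 sS in h3; have {}h3 := h3 isT.
  have := powRN_le (ltW a0) (heat_gt0 w s0) (ltW h1); rewrite cE => h4.
  by move: h3; rewrite -/Z; lra.
have [Ifin|] := boolP (intV (fun y => (heat g S y `^ (- a) * phi S (y - w))%:E) < +oo)%E; last first.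
  by rewrite -leNgt leye_eq => /eqP ->; rewrite leey.
set I := intV _ in Ifin *.
have I0 : (0 <= I)%E by apply: integral_ge0 => t _; rewrite lee_fin mulr_ge0 ?phi_ge0 ?powR_ge0.
have IE : I = (fine I)%:E by rewrite fineK// ge0_fin_numE.
rewrite IE lee_fin; apply/ler_addgt0Pr => e e0.
pose Q := expR (L * S) * bracket w `^ k.
have Q0 : 0 < Q by rewrite mulr_gt0 ?expR_gt0// powR_gt0// bracket_gt0.
have [|K K0 H] := step (e / Q); first by rewrite divr_gt0.
apply: le_trans H _; rewrite -/Q divfK ?gt_eqF// lerD2r.
have cpsi := @psi_continuous K; have psi0 v := psi_ge0 v K0.
have psifin t u := @psi_fin K t u K0.
have psiI : gauss_integrable (psi K) by exact: flow_gauss_integrable.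
rewrite -lee_fin -IE -heatE// /I; apply: ge0_le_integral => //.
- by move=> t _; rewrite lee_fin mulr_ge0 ?phi_ge0.
- exact: measurable_mul_phi.
- apply: (@measurable_toV_compE _ _ (fun y => heat g S y `^ (- a) * phi S (y - w))).
  apply: mulf_continuous; last exact: phiB_continuous.
  move=> x; apply: (@continuous_at_comp _ 'rV[R]_n _ _ _ (fun h => h `^ (- a))); first exact: cH.
  apply: differentiable_continuous; apply/derivable1_diffP.
  by have H' := is_derive1_powR (- a) (heat_gt0 x S0); exact: ex_derive.
by move=> t _; rewrite lee_fin ler_wpM2r ?phi_ge0// ge_min lexx.
Qed.

End Comparison.

(** * Risks *)

Section MeasurableRows.
Variables (R : realType) (dO : measure_display) (O : measurableType dO) (n : nat).

(** Measurability into row vectors, in the coordinatewise form that [measurable_continuous_comp]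
    requires. *)
Definition mrow (F : O -> 'rV[R]_n) := forall i, measurable_fun setT (fun w => F w 0 i).

Lemma mrowZ (c : R) F : mrow F -> mrow (fun w => c *: F w).
Proof. by move=> mF i; under eq_fun do rewrite mxE; exact: measurable_funM. Qed.

Lemma mrowD F G : mrow F -> mrow G -> mrow (fun w => F w + G w).
Proof. by move=> mF mG i; under eq_fun do rewrite mxE; exact: measurable_funD. Qed.

Lemma mrowB F G : mrow F -> mrow G -> mrow (fun w => F w - G w).
Proof. by move=> mF mG i; under eq_fun do rewrite !mxE; exact: measurable_funB. Qed.

End MeasurableRows.

Lemma mrow_fst (R : realType) (n k : nat) :
  mrow (fun p : ms_sort (euclid R n) * ms_sort (euclid R k) => toV p.1).
Proof. by move=> i; apply: (measurableT_comp (measurable_toV i)); exact: measurable_fst. Qed.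

Lemma mrow_snd (R : realType) (n k : nat) :
  mrow (fun p : ms_sort (euclid R n) * ms_sort (euclid R k) => toV p.2).
Proof. by move=> i; apply: (measurableT_comp (measurable_toV i)); exact: measurable_snd. Qed.

(** Lets statements about an arbitrary row vector use measurability, which is stated along [toV]. *)
Lemma toV_surj (R : realType) n (x : 'rV[R]_n) : exists t, x = toV t.
Proof.
elim: n x => [|n IH] x; first by exists tt; apply/rowP => -[].
have [t Et] := IH (rsubmx (x : 'rV[R]_(1 + n))).
exists (x 0 0, t); apply/rowP => j; case: (@split_ordP 1 n j) => i ->.
  transitivity (x 0 0); last exact/esym/row_mx_l.
  by rewrite (ord1 i); congr (x _ _); exact/val_inj.
transitivity (toV t 0 i); last exact/esym/row_mx_r.
by rewrite -Et mxE.
Qed.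

Section Risk.
Variables (R : realType) (d : nat) (alpha vx vy : R).
Hypothesis vx0 : 0 < vx.
Hypothesis vy0 : 0 < vy.
Hypothesis alpha1 : -1 < alpha < 1.
Variable mu : 'rV[R]_d.

Let C := 4 / (1 - alpha ^+ 2).

Let C0 : 0 < C.
Proof. by case/andP: alpha1 => h1 h2; rewrite divr_gt0// subr_gt0; nra. Qed.

(* The part of the risk integrand that depends on the predictive density. *)
Definition affinity (p : 'rV[R]_d -> 'rV[R]_d -> R) (x y : 'rV[R]_d) : R :=
  C * ((p x y / phi vy (y - mu)) `^ ((1 + alpha) / 2) * phi vy (y - mu)) * phi vx (x - mu).

Lemma affinity_ge0 p x y : 0 <= affinity p x y.
Proof.
by rewrite mulr_ge0 ?phi_ge0// mulr_ge0 ?(ltW C0)// mulr_ge0 ?phi_ge0// powR_ge0.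
Qed.

(** The constant in [falpha] contributes a Gaussian of mass C in y and again in x. [iint_cphiB]
    handles both subtractions even where the affinity has infinite integral, so no integrability has
    to be established. *)
Lemma riskE (p : 'rV[R]_d -> 'rV[R]_d -> R) :
  measurable_fun setT (fun t : ms_sort (euclid R d) * ms_sort (euclid R d) =>
    affinity p (toV t.1) (toV t.2)) ->
  (risk alpha vx vy p mu =
    C%:E - intV (fun x => intV (fun y => (affinity p x y)%:E)))%E.
Proof.
move=> mp.
pose B x y := C * ((p x y / phi vy (y - mu)) `^ ((1 + alpha) / 2) * phi vy (y - mu)).
have B0 x y : 0 <= B x y.
  by rewrite mulr_ge0 ?(ltW C0)// mulr_ge0 ?phi_ge0// powR_ge0.
have mB : measurable_fun setT (fun t : ms_sort (euclid R d) * ms_sort (euclid R d) =>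
    B (toV t.1) (toV t.2)).
  rewrite (_ : (fun t => _) = fun t => affinity p (toV t.1) (toV t.2) * (phi vx (toV t.1 - mu))^-1).
    apply: measurable_funM => //.
    apply: (@measurable_continuous_comp _ _ _ _ (fun t : ms_sort (euclid R d) * ms_sort (euclid R d) => toV t.1)
      (fun x => (phi vx (x - mu))^-1)); first exact: mrow_fst.
    move=> x; have nz : phi vx (x - mu) != 0 by rewrite gt_eqF// phi_gt0.
    exact: (cvgV nz (@phiB_continuous R d vx mu x)).
  by apply/funext => t; rewrite /affinity mulfK// gt_eqF// phi_gt0.
have mBE : measurable_fun setT (fun t : ms_sort (euclid R d) * ms_sort (euclid R d) =>
    (B (toV t.1) (toV t.2))%:E) by exact/measurable_EFinP.
have DE x : (Dalpha alpha vy p x mu = C%:E - intV (fun y => (B x y)%:E))%E.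
  have [t ->] := toV_surj x.
  rewrite -(@iint_cphiB _ _ C vy mu) ?(ltW C0)//; last 2 first.
  - by move=> v; rewrite lee_fin.
  - exact: (measurableT_comp mBE (measurable_pair1 t)).
  congr iint; apply/funext => y; rewrite -EFinB; congr EFin.
  rewrite /falpha /B -/C; set X := _ `^ _; set Y := phi _ _; ring.
rewrite /risk.
have E x : (Dalpha alpha vy p x mu * (phi vx (x - mu))%:E =
    (C * phi vx (x - mu))%:E - intV (fun y => (affinity p x y)%:E))%E.
  rewrite DE.
  have -> : intV (fun y => (affinity p x y)%:E) = (intV (fun y => (B x y)%:E) * (phi vx (x - mu))%:E)%E.
    have [t Et] := toV_surj x.
    rewrite /intV -ge0_integralZr//.
    - by rewrite Et; exact: (measurableT_comp mBE (measurable_pair1 t)).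
    - by move=> y _; rewrite lee_fin.
    - by rewrite lee_fin phi_ge0.
  have : (0 <= intV (fun y => (B x y)%:E))%E by apply: integral_ge0 => t _; rewrite lee_fin.
  case: (intV _) => [r| |]// _.
    by rewrite -EFinB -!EFinM -EFinB mulrBl.
  by rewrite mulyr gtr0_sg ?phi_gt0// mul1e/= mulNyr gtr0_sg ?phi_gt0// mul1e.
under [X in iint X]eq_fun do rewrite E.
rewrite iint_cphiB ?(ltW C0)//.
- by move=> x; apply: integral_ge0 => t _; rewrite lee_fin affinity_ge0.
- apply: (@measurable_intV _ _ _ (fun x y => (affinity p x y)%:E)).
    exact/measurable_EFinP.
  by move=> x y; rewrite lee_fin affinity_ge0.
Qed.

End Risk.

(** * Completing the square in the Gaussian weight *)

Section Gaussian.
Variables (R : realType) (d : nat) (vx vy be : R).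
Hypothesis vx0 : 0 < vx.
Hypothesis vy0 : 0 < vy.
Hypothesis be01 : 0 < be < 1.
Variable mu : 'rV[R]_d.
Let ga := 1 / (1 + be * vx / vy).
Let S := (1 - ga) ^+ 2 * (vy / ga).

Let be0 : 0 < be. Proof. by case/andP: be01. Qed.

(** The exponents of [phi_factor] in one coordinate, with u and v measured from mu. *)
Lemma quadratic_identity (u v : R) :
  (1 - be) * ((v - u) ^+ 2 / (2 * (vy / ga))) + be * (v ^+ 2 / (2 * vy)) + u ^+ 2 / (2 * vx) =
  (ga * u + (1 - ga) * v) ^+ 2 / (2 * (vx * ga)) + (u - (ga * u + (1 - ga) * v)) ^+ 2 / (2 * S).
Proof.
have h1 : vy + be * vx != 0 by rewrite gt_eqF// addr_gt0// mulr_gt0.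
have h2 : be * vx != 0 by rewrite gt_eqF// mulr_gt0.
rewrite /S /ga; field.
have h3 : vy + be * vx - vy != 0 by rewrite addrAC subrr add0r.
by rewrite h1 h3 !gt_eqF.
Qed.

(* Completing the square: in the variables [x] and [w = ga x + (1 - ga) y] the
   weight factors into the law of [w] and a Gaussian centred at [w]. *)
Lemma phi_factor : exists2 c, 0 < c & forall x y : 'rV[R]_d,
  phi (vy / ga) (y - x) `^ (1 - be) * phi vy (y - mu) `^ be * phi vx (x - mu) =
  c * (phi (vx * ga) (ga *: x + (1 - ga) *: y - mu) *
       phi S (x - (ga *: x + (1 - ga) *: y))).
Proof.
have ga0 : 0 < ga by rewrite divr_gt0// addr_gt0// divr_gt0// mulr_gt0.
have ga1 : 0 < 1 - ga.
  rewrite subr_gt0 ltr_pdivrMr ?mul1r; last by rewrite addr_gt0// divr_gt0// mulr_gt0.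
  by rewrite ltrDl divr_gt0// mulr_gt0.
have S0 : 0 < S by rewrite mulr_gt0 ?exprn_gt0// divr_gt0.
have T0 : 0 < vy / ga by rewrite divr_gt0.
have v0 : 0 < vx * ga by rewrite mulr_gt0.
pose k (s : R) := (2 * pi * s) `^ (- d%:R / 2).
have k0 s : 0 < s -> 0 < k s by move=> s0; rewrite powR_gt0 ?mulr_gt0 ?pi_gt0.
(* The ratio of the normalising constants of the two sides, common to both risks. *)
exists (k (vy / ga) `^ (1 - be) * k vy `^ be * k vx / (k (vx * ga) * k S)).
  by rewrite divr_gt0//; do ?[by apply: k0|apply: mulr_gt0|apply: powR_gt0].
move=> x y; set w := ga *: x + _.
have phiE s (z : 'rV[R]_d) : phi s z = k s * expR (- sqnorm z / (2 * s)) by [].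
rewrite !phiE !powRM ?expR_ge0 ?(ltW (k0 _ _))// -!expRM.
set A := k (vy / ga) `^ _; set A2 := k vy `^ _.
have -> : forall E1 E2 E3, A * E1 * (A2 * E2) * (k vx * E3) = A * A2 * k vx * (E1 * E2 * E3).
  by move=> *; ring.
have -> : forall E1 E2, A * A2 * k vx / (k (vx * ga) * k S) * (k (vx * ga) * E1 * (k S * E2)) =
    A * A2 * k vx * (E1 * E2).
  by move=> *; field; rewrite !gt_eqF ?k0.
congr (_ * _); rewrite -!expRD; congr expR.
rewrite /sqnorm -!sumrN !mulr_suml -!big_split/=; apply: eq_bigr => i _.
have := quadratic_identity (x 0 i - mu 0 i) (y 0 i - mu 0 i).
rewrite /w !mxE.
have -> : y 0 i - mu 0 i - (x 0 i - mu 0 i) = y 0 i - x 0 i by ring.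
have -> : ga * (x 0 i - mu 0 i) + (1 - ga) * (y 0 i - mu 0 i) =
  ga * x 0 i + (1 - ga) * y 0 i - mu 0 i by ring.
have -> : x 0 i - mu 0 i - (ga * x 0 i + (1 - ga) * y 0 i - mu 0 i) =
  x 0 i - (ga * x 0 i + (1 - ga) * y 0 i) by ring.
move=> H; rewrite !mulNr -!opprD; congr (- _).
by rewrite -H; ring.
Qed.

End Gaussian.

(** * Lyapunov's inequality for Gaussian expectations *)

Section Lyapunov.
Variables (R : realType) (d : nat) (M : 'rV[R]_d -> R) (q k t : R) (x : 'rV[R]_d).
Hypothesis cM : continuous M.
Hypothesis Mpos : forall v, 0 < M v.
Hypothesis qk : 0 < q < k.
Hypothesis fin_k : (EZ (fun z => (M (t *: z + x) `^ k)%R) < +oo)%E.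

Lemma powR_comp_continuous (r : R) : continuous (fun v => M v `^ r).
Proof.
move=> v; apply: (@continuous_at_comp _ 'rV[R]_d _ _ _ (fun h => h `^ r)); first exact: cM.
apply: differentiable_continuous; apply/derivable1_diffP.
by have H := is_derive1_powR r (Mpos v); exact: ex_derive.
Qed.

Let mphi (r c : R) : measurable_fun setT
  (fun u => (c * (M (t *: @toV R d u + x) `^ r * phi 1 (toV u)))%:E).
Proof.
apply: (@measurable_toV_compE _ _ (fun z => c * (M (t *: z + x) `^ r * phi 1 z))).
apply: mulf_continuous; first exact: cst_continuous.
apply: mulf_continuous; last exact: phi_continuous.
exact: (comp_affine_continuous (@powR_comp_continuous r)).
Qed.

(** Young's inequality with a free constant c is integrated against the Gaussian; taking c equal to
    [H = E[M^k]] gives [H^((k-q)/k) E[M^q] <= H]. The choice c = 1 is made first, to show that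
    E[M^q] is finite. *)
Lemma lyapunov : fine (EZ (fun z => M (t *: z + x) `^ q)) <=
  fine (EZ (fun z => M (t *: z + x) `^ k)) `^ (q / k).
Proof.
have /andP[q0 qltk] := qk; have k0 : 0 < k by exact: lt_trans qltk.
have kq0 : 0 < k - q by rewrite subr_gt0.
have EZr r : EZ (fun z => M (t *: z + x) `^ r) =
    intV (fun z => (M (t *: z + x) `^ r * phi 1 z)%:E).
  exact: (@EZE R d (fun v => M v `^ r) (@powR_comp_continuous r) (fun v => powR_ge0 _ _)).
have EZ0 r : (0 <= EZ (fun z => (M (t *: z + x) `^ r)%R))%E.
  by rewrite EZr; apply: integral_ge0 => u _; rewrite lee_fin mulr_ge0 ?phi_ge0 ?powR_ge0.
set H := fine (EZ (fun z => M (t *: z + x) `^ k)).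
have HE : EZ (fun z => M (t *: z + x) `^ k) = H%:E by rewrite fineK// ge0_fin_numE.
have H0 : 0 <= H by rewrite fine_ge0.
have young y c : 0 < y -> 0 <= c ->
    c `^ ((k - q) / k) * y `^ q <= q / k * y `^ k + (k - q) / k * c.
  move=> y0 c0.
  have p1 : 0 < k / q by rewrite divr_gt0.
  have p2 : 0 < k / (k - q) by rewrite divr_gt0.
  have conj : (k / q)^-1 + (k / (k - q))^-1 = 1.
    by rewrite !invf_div -mulrDl subrKC divff// gt_eqF.
  have := conjugate_powR (powR_ge0 y q) (powR_ge0 c ((k - q) / k)) p1 p2 conj.
  rewrite -!powRrM mulrCA divff ?gt_eqF// mulr1 mulrA divfK ?gt_eqF// divff ?gt_eqF// powRr1//.
  by rewrite !invf_div mulrC (mulrC (y `^ k)) (mulrC c).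
have intle c : 0 <= c -> ((c `^ ((k - q) / k))%:E * EZ (fun z => (M (t *: z + x) `^ q)%R) <=
    (q / k * H + (k - q) / k * c)%:E)%E.
  move=> c0; rewrite EZr /intV -ge0_integralZl//; last 3 first.
  - by have := mphi q 1; under eq_fun do rewrite mul1r.
  - by move=> u _; rewrite lee_fin mulr_ge0 ?phi_ge0 ?powR_ge0.
  - by rewrite lee_fin powR_ge0.
  have -> : (q / k * H + (k - q) / k * c)%:E = (\int[ms_mu (euclid R d)]_u
      ((q / k * (M (t *: @toV R d u + x) `^ k * phi 1 (toV u)))%:E +
       ((k - q) / k * c * phi 1 (toV u - 0))%:E))%E.
    have qk0 : 0 <= q / k by rewrite divr_ge0// ltW.
    have c'0 : 0 <= (k - q) / k * c by rewrite mulr_ge0// divr_ge0// ltW.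
    rewrite ge0_integralD//; last 3 first.
    - by move=> u _; rewrite lee_fin mulr_ge0// mulr_ge0 ?phi_ge0 ?powR_ge0.
    - by move=> u _; rewrite lee_fin mulr_ge0 ?phi_ge0.
    - apply: (@measurable_toV_compE _ _ (fun z => (k - q) / k * c * phi 1 (z - 0))).
      by apply: mulf_continuous; [exact: cst_continuous|exact: phiB_continuous].
    rewrite -[X in (_ + X)%E]/(intV (fun z => ((k - q) / k * c * phi 1 (z - 0))%:E)).
    rewrite intV_cphi// EFinD; congr (_ + _)%E.
    under [RHS]eq_integral do rewrite EFinM.
    rewrite ge0_integralZl//; last 2 first.
    - by have := mphi k 1; under eq_fun do rewrite mul1r.
    - by move=> u _; rewrite lee_fin mulr_ge0 ?phi_ge0 ?powR_ge0.
    by rewrite EFinM -HE EZr.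
  apply: ge0_le_integral => //.
  - move=> u _; rewrite mule_ge0// lee_fin ?powR_ge0// mulr_ge0 ?phi_ge0 ?powR_ge0//.
  - by under eq_fun do rewrite -EFinM; exact: mphi.
  - apply: emeasurable_funD; first exact: mphi.
    apply: (@measurable_toV_compE _ _ (fun z => (k - q) / k * c * phi 1 (z - 0))).
    by apply: mulf_continuous; [exact: cst_continuous|exact: phiB_continuous].
  move=> u _; rewrite -EFinM -EFinD lee_fin subr0.
  have := phi_ge0 1 (toV u); move: (phi 1 (toV u)) => Y Y0.
  have := young (M (t *: toV u + x)) c (Mpos _) c0.
  by move=> le1; have /= := ler_wpM2r Y0 le1; congr (is_true (_ <= _)); ring.
have finq : (EZ (fun z => (M (t *: z + x) `^ q)%R) < +oo)%E.
  have := intle 1 ler01; rewrite powR1 mul1e => le1; apply: le_lt_trans le1 _; exact: ltry.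
have NE : EZ (fun z => M (t *: z + x) `^ q) = (fine (EZ (fun z => M (t *: z + x) `^ q)))%:E.
  by rewrite fineK// ge0_fin_numE.
set N := fine _ in NE *.
have Hpos : 0 < H.
  rewrite -lte_fin -HE.
  apply: (@EZ_gt0 R d (fun v => M v `^ k) (@powR_comp_continuous k) (fun v => powR_ge0 _ _)).
  by move=> v; exact: powR_gt0.
have := intle H H0; rewrite NE -EFinM lee_fin.
have -> : q / k * H + (k - q) / k * H = H by field; rewrite gt_eqF.
rewrite mulrC -ler_pdivlMr ?powR_gt0// => /le_trans; apply.
rewrite -{1}[H]powRr1// -powRB ?(gt_eqF Hpos) ?implybT//.
by rewrite (_ : 1 - (k - q) / k = q / k)//; field; rewrite gt_eqF.
Qed.

End Lyapunov.

(** * From (x, y) to (x, w) *)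

Section ChangeOfVariables.
Variables (R : realType) (d : nat) (c v S ga : R) (mu : 'rV[R]_d).
Hypothesis c0 : 0 <= c.
Hypothesis ga1 : 0 < 1 - ga.
Variables A B : 'rV[R]_d -> R.
Hypothesis cA : continuous A.
Hypothesis cB : continuous B.
Hypothesis A0 : forall w, 0 <= A w.
Hypothesis B0 : forall x, 0 <= B x.

(** The common shape of both affinities after completing the square: A and B are powers of M and N
    for the Bayes density, and 1 for the uniform one. *)
Definition weight (x w : 'rV[R]_d) : R :=
  c * (A w * B x * (phi v (w - mu) * phi S (x - w))).

Lemma weight_ge0 x w : 0 <= weight x w.
Proof. by rewrite mulr_ge0// mulr_ge0// mulr_ge0 ?phi_ge0. Qed.

Lemma weight_measurable (dO : measure_display) (O : measurableType dO)
    (X W : O -> 'rV[R]_d) : mrow X -> mrow W ->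
  measurable_fun setT (fun o => weight (X o) (W o)).
Proof.
move=> mX mW; apply: measurable_funM => //; apply: measurable_funM.
  by apply: measurable_funM; exact: measurable_continuous_comp.
apply: measurable_funM.
  apply: (@measurable_continuous_comp _ _ _ _ W (fun w => phi v (w - mu))) => //.
  exact: phiB_continuous.
apply: (@measurable_continuous_comp _ _ _ _ (fun o => X o - W o) (phi S)).
  exact: mrowB.
exact: phi_continuous.
Qed.

Lemma weight_continuous x : continuous (weight x).
Proof.
apply: mulf_continuous; first exact: cst_continuous.
apply: mulf_continuous; first by apply: mulf_continuous => //; exact: cst_continuous.
apply: mulf_continuous; first exact: phiB_continuous.
move=> w; apply: (@continuous_comp _ _ _ (fun w : 'rV[R]_d => x - w) (phi S)).
  by apply: (@cvgB _ _ _ (nbhs w) _ (fun=> x) id); [exact: cvg_cst|exact: cvg_id].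
exact: phi_continuous.
Qed.

(** For fixed x, [y |-> ga x + (1 - ga) y] has Jacobian [(1 - ga)^d]; Tonelli's theorem then puts w
    outside, where the two risks are compared pointwise. *)
Lemma intV_weight : (((1 - ga) ^+ d)%:E *
    intV (fun x => intV (fun y => (weight x (ga *: x + (1 - ga) *: y))%:E)) =
  intV (fun w => intV (fun x => (weight x w)%:E)))%E.
Proof.
have mw : measurable_fun setT (fun p : ms_sort (euclid R d) * ms_sort (euclid R d) =>
    (weight (toV p.1) (toV p.2))%:E).
  by apply/measurable_EFinP; apply: weight_measurable; [exact: mrow_fst|exact: mrow_snd].
have w0 x w : (0 <= (weight x w)%:E)%E by rewrite lee_fin weight_ge0.
apply: etrans (intV_swap mw w0).
rewrite /intV -ge0_integralZl//; last 3 first.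
- apply: (@measurable_intV _ _ _ (fun x y => (weight x (ga *: x + (1 - ga) *: y))%:E)).
    apply/measurable_EFinP; apply: weight_measurable; first exact: mrow_fst.
    by apply: mrowD; apply: mrowZ; [exact: mrow_fst|exact: mrow_snd].
  by move=> x w; rewrite lee_fin weight_ge0.
- by move=> t _; apply: integral_ge0 => u _; rewrite lee_fin weight_ge0.
- by rewrite lee_fin exprn_ge0// ltW.
apply: eq_integral => t _.
have H := @intV_affine R d (weight (toV t)) (1 - ga) (ga *: toV t)
  (@weight_continuous (toV t)) (weight_ge0 (toV t)) ga1.
rewrite [X in (_ * X)%E](_ : _ = intV (fun u : 'rV[R]_d =>
    (weight (toV t) ((1 - ga) *: u + ga *: toV t))%:E)); first exact (esym H).
by apply: eq_integral => u _; rewrite addrC.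
Qed.

Lemma measurable_intV_weight :
  measurable_fun setT (fun t => intV (fun x => (weight x (@toV R d t))%:E)).
Proof.
apply: (@measurable_intV _ _ _ (fun w x => (weight x w)%:E)).
  by apply/measurable_EFinP; apply: weight_measurable; [exact: mrow_snd|exact: mrow_fst].
by move=> x w; rewrite lee_fin weight_ge0.
Qed.

End ChangeOfVariables.

Lemma lee_EFin_pmul2l (R : realType) (r : R) (x y x' y' : \bar R) : 0 < r ->
  (r%:E * x = x' -> r%:E * y = y' -> x' <= y' -> x <= y)%E.
Proof. by move=> r0 <- <-; rewrite lee_pmul2l// lte_fin. Qed.

(** * From the heat comparison to the risks *)

Section Main.
Variables (R : realType) (d : nat) (vx vy alpha : R) (prior : 'rV[R]_d -> R).
Hypothesis d0 : (0 < d)%N.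
Hypothesis vx0 : 0 < vx.
Hypothesis vy0 : 0 < vy.
Hypothesis alpha1 : -1 < alpha < 1.
Let be := beta alpha.
Let q := 1 / be.
Let k := kappa alpha.
Let ga := gam alpha vx vy.
Let t1 := xi alpha vx vy.
Let v := vx * ga.
Let M w := margR prior w v.
Hypothesis reg : regular_prior prior v.
Hypothesis lap_le0 : forall (u : 'rV[R]_d) (t : R), 0 <= t <= t1 ->
  lap (fun w => fine (EZ (fun z => M (t *: z + w) `^ k)) `^ (cbeta alpha / k)) u <= 0.

Let be01 : 0 < be < 1.
Proof. by case/andP: alpha1 => h1 h2; rewrite /be /beta; apply/andP; split; lra. Qed.
Let be0 : 0 < be. Proof. by case/andP: be01. Qed.
Let q1 : 1 < q.
Proof. by rewrite /q div1r invf_gt1//; case/andP: be01. Qed.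
Let q0 : 0 < q. Proof. exact: lt_trans q1. Qed.
Let qk : q < k. Proof. exact: floorD1_gt. Qed.
Let k0 : 0 < k. Proof. exact: lt_trans qk. Qed.
Let bv0 : 0 < be * vx / vy. Proof. by rewrite divr_gt0// mulr_gt0. Qed.
Let ga0 : 0 < ga. Proof. by rewrite /ga /gam divr_gt0// addr_gt0. Qed.
Let ga1 : 0 < 1 - ga.
Proof. by rewrite subr_gt0 /ga /gam div1r invf_lt1 ?ltrDl// addr_gt0. Qed.
Let t10 : 0 < t1.
Proof. by rewrite /t1 /xi mulr_gt0// sqrtr_gt0 divr_gt0. Qed.
Let S := t1 ^+ 2.
Let S0 : 0 < S. Proof. by rewrite exprn_gt0. Qed.
Let SE : S = (1 - ga) ^+ 2 * (vy / ga).
Proof. by rewrite /S /t1 /xi exprMn sqr_sqrtr// divr_ge0// ltW. Qed.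

Let cM : continuous M.
Proof. by case: reg => _ [_ [H _]] w; apply: differentiable_continuous; exact: H. Qed.

Let Mpos w : 0 < M w.
Proof. by case: reg => _ [H _]; exact: fine_gt0. Qed.

Let Mfin (r t : R) (u : 'rV[R]_d) : 0 < r -> 0 <= t ->
  (EZ (fun z => (M (t *: z + u) `^ r)%R) < +oo)%E.
Proof. by case: reg => _ [_ [_ [_ [_ [H _]]]]]; exact: H. Qed.

Let cEZ (r : R) : 0 < r -> continuous (fun u => fine (EZ (fun z => M (t1 *: z + u) `^ r))).
Proof.
case: reg => _ [_ [_ [_ [_ [_ H]]]]] r0 u; apply: differentiable_continuous.
by have [Hd _] := H r t1 r0 (ltW t10); exact: Hd.
Qed.

Let N u := fine (EZ (fun z => M (t1 *: z + u) `^ q)).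

Let Npos u : 0 < N u.
Proof.
rewrite /N fine_gt0//; apply/andP; split; last by apply: Mfin => //; exact: ltW.
apply: (@EZ_gt0 R d (fun v => M v `^ q) (@powR_comp_continuous _ _ _ cM Mpos q) (fun v => powR_ge0 _ _)).
by move=> w; exact: powR_gt0.
Qed.

Let g w := M w `^ k.
Let cg : continuous g. Proof. exact: powR_comp_continuous. Qed.
Let gpos w : 0 < g w. Proof. by rewrite powR_gt0. Qed.
Let gfin (t : R) u : 0 <= t -> (EZ (fun z => g (t *: z + u)) < +oo)%E.
Proof. by move=> t0; exact: Mfin. Qed.
(** Makes both ends match: [g^-a = M^-(q - 1)], and since [q (1 - be) = q - 1], also
    [H^-a = (H^(q/k))^-(1 - be)]. *)
Let a := (q - 1) / k.
Let a01 : 0 < a < 1.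
Proof.
rewrite divr_gt0 ?subr_gt0//= ltr_pdivrMr// mul1r.
by apply: lt_trans qk; rewrite ltrBlDr ltrDl.
Qed.

Let heatSE u : heat g S u = fine (EZ (fun z => M (t1 *: z + u) `^ k)).
Proof. by rewrite /heat -(EZ_phi u cg (fun w => ltW (gpos w)) t10). Qed.

(** The hypothesis at [t = sqrt s], with the Laplacian of [H^b] expanded and its positive factor
    [b H^(b-2)] divided out. *)
Let superharmonic (s : R) x : 0 < s <= S ->
  ((1 - a) / 2 - 1) * (\sum_(i < d) heat1 g s i x ^+ 2) +
  heat g s x * (\sum_(i < d) heat2 g s i x) <= 0.
Proof.
move=> /andP[s0 sS]; pose b := (1 - a) / 2.
have bE : cbeta alpha / k = b.
  have kn : k != 0 by rewrite gt_eqF.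
  rewrite /cbeta -/k -/be -/q /b /a.
  by move: (k) (q) kn => k' q' kn; field.
have b0 : 0 < b by rewrite divr_gt0// subr_gt0; case/andP: a01.
have g0 w := ltW (gpos w).
have gI : gauss_integrable g by exact: flow_gauss_integrable.
have t01 : 0 <= Num.sqrt s <= t1.
  by rewrite sqrtr_ge0/= -(ger0_norm (ltW t10)) -sqrtr_sqr ler_sqrt// ltW.
have := lap_le0 x t01; rewrite bE.
rewrite (_ : (fun w => _) = fun w => heat g s w `^ b); last first.
  by apply/funext => w; rewrite -flow_heat.
have hpos y : 0 < heat g s y by exact: heat_gt0.
rewrite (lap_D2 _ (fun i => D2_powR b hpos (D2_heat i cg g0 gI s0))).
have h0 := hpos x.
have E : heat g s x `^ (b - 1) = heat g s x `^ (b - 2) * heat g s x.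
  have -> : b - 1 = b - 2 + 1 by ring.
  by rewrite powRD ?powRr1 ?(ltW h0)// (gt_eqF h0) implybT.
rewrite big_split/= -!mulr_sumr E.
have -> : forall X Y P, b * (b - 1) * P * X + b * (P * heat g s x) * Y =
  b * P * ((b - 1) * X + heat g s x * Y) by move=> X Y P; ring.
by rewrite pmulr_rle0// mulr_gt0// powR_gt0.
Qed.

(** The negative power reverses Lyapunov's inequality, so replacing [H^(q/k)] by N only enlarges the
    integral. *)
Let mass_ge w : ((M w `^ (- (q - 1)))%:E <=
  intV (fun y => (N y `^ (- (1 - be)) * phi S (y - w))%:E))%E.
Proof.
have cH : continuous (heat g S).
  by rewrite (_ : heat g S = fun u => fine (EZ (fun z => M (t1 *: z + u) `^ k)));
    [exact: cEZ|apply/funext => u; exact: heatSE].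
have := heat_powRN_ge d0 cg gpos gfin a01 S0 cH superharmonic w.
have -> : g w `^ (- a) = M w `^ (- (q - 1)).
  by rewrite /g -powRrM mulrN /a mulrCA divff ?mulr1// gt_eqF.
move=> /le_trans; apply; apply: ge0_le_integral => //.
- by move=> t _; rewrite lee_fin mulr_ge0 ?phi_ge0 ?powR_ge0.
- apply: (@measurable_toV_compE _ _ (fun y => heat g S y `^ (- a) * phi S (y - w))).
  apply: mulf_continuous; last exact: phiB_continuous.
  apply: powR_comp_continuous => // u; exact: heat_gt0.
- apply: (@measurable_toV_compE _ _ (fun y => N y `^ (- (1 - be)) * phi S (y - w))).
  apply: mulf_continuous; last exact: phiB_continuous.
  by apply: powR_comp_continuous => //; exact: cEZ.
move=> t _; rewrite lee_fin ler_wpM2r ?phi_ge0//; set y := toV t.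
have NH : N y <= heat g S y `^ (q / k).
  rewrite heatSE; apply: lyapunov => //; first by rewrite q0.
  by apply: Mfin => //; exact: ltW.
have be1 : 0 <= 1 - be by case/andP: be01 => _ ?; rewrite subr_ge0 ltW.
have -> : heat g S y `^ (- a) = (heat g S y `^ (q / k)) `^ (- (1 - be)).
  rewrite -powRrM; congr (_ `^ _); rewrite /a /q.
  have [kn bn] : k != 0 /\ be != 0 by rewrite !gt_eqF.
  by move: (k) (be) kn bn => k' b' kn bn; field; rewrite kn.
exact: powRN_le.
Qed.

Section Mean.
Variable mu : 'rV[R]_d.

Let C := 4 / (1 - alpha ^+ 2).
Let C0 : 0 < C.
Proof. by case/andP: alpha1 => h1 h2; rewrite divr_gt0// subr_gt0; nra. Qed.

Let expE : (1 + alpha) / 2 = 1 - be.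
Proof. by rewrite /be /beta; field. Qed.

Let powR_ratio (m n : R) : 0 < m -> 0 < n ->
  (m `^ q / n) `^ (1 - be) = m `^ (q - 1) * n `^ (- (1 - be)).
Proof.
move=> m0 n0; have -> : n^-1 = n `^ (-1) by rewrite powR_inv1// ltW.
rewrite powRM ?powR_ge0// -!powRrM mulN1r; congr (_ `^ _ * _).
by rewrite /q; field; rewrite gt_eqF.
Qed.

(** Both predictive densities are a factor Lam times the same Gaussian. The density of y enters with
    power -(1 - be) from the ratio and 1 from the loss, which leaves the power be that [phi_factor]
    expects. *)
Let affinityE (p : 'rV[R]_d -> 'rV[R]_d -> R) (Lam : R) x y : 0 < Lam ->
  p x y = Lam * phi (vy / ga) (y - x) ->
  affinity alpha vx vy mu p x y = C * (Lam `^ (1 - be) *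
    (phi (vy / ga) (y - x) `^ (1 - be) * phi vy (y - mu) `^ be * phi vx (x - mu))).
Proof.
move=> L0 pE; rewrite /affinity -/C expE pE.
set T := phi (vy / ga) _; set Y := phi vy _; set X := phi vx _.
have T0 : 0 < T by rewrite phi_gt0// divr_gt0.
have Y0 : 0 < Y by rewrite phi_gt0.
have Y1 : Y `^ be = Y / Y `^ (1 - be).
  have {1}-> : be = 1 - (1 - be) by ring.
  by rewrite powRB ?powRr1 ?(ltW Y0)// (gt_eqF Y0) implybT.
have LT0 : 0 <= Lam * T by rewrite ltW// mulr_gt0.
have -> : (Lam * T / Y) `^ (1 - be) = (Lam * T) `^ (1 - be) / Y `^ (1 - be).
  have Yn : Y != 0 by rewrite gt_eqF.
  rewrite -[in RHS](divfK Yn (Lam * T)).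
  by rewrite [in RHS]powRM ?divr_ge0 ?(ltW Y0)// mulfK// gt_eqF// powR_gt0.
by rewrite powRM ?(ltW L0) ?(ltW T0)// Y1; ring.
Qed.

Lemma risk_bayes_le_unif :
  (risk alpha vx vy (pred_bayes prior alpha vx vy) mu
     <= risk alpha vx vy (@pred_unif R d alpha vx vy) mu)%E.
Proof.
have [c c0 cE] := phi_factor vx0 vy0 be01 mu.
have ga'E : 1 / (1 + be * vx / vy) = ga by [].
rewrite ga'E -SE -/v in cE.
have Cc0 : 0 <= C * c by rewrite mulr_ge0// ltW.
pose A w := M w `^ (q - 1); pose B x := N x `^ (- (1 - be)).
have cA : continuous A by exact: powR_comp_continuous.
have cB : continuous B by apply: powR_comp_continuous => //; exact: cEZ.
have A0 w : 0 <= A w by exact: powR_ge0.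
have B0 x : 0 <= B x by exact: powR_ge0.
have c1 : continuous (fun _ : 'rV[R]_d => 1 : R) by exact: cst_continuous.
have p10 (w : 'rV[R]_d) : 0 <= 1 :> R by [].
have bayesE x y : affinity alpha vx vy mu (pred_bayes prior alpha vx vy) x y =
    weight (C * c) v S mu A B x (ga *: x + (1 - ga) *: y).
  set w := ga *: x + (1 - ga) *: y.
  have L0 : 0 < M w `^ q / N x by rewrite divr_gt0 ?powR_gt0.
  have pE : pred_bayes prior alpha vx vy x y =
      M w `^ q / N x * phi (vy / ga) (y - x).
    have E : (fun z => M (t1 *: z + x) `^ q) = fun z => M (x + t1 *: z) `^ q.
      by apply/funext => z; rewrite (addrC (t1 *: z) x).
    by rewrite /N E.
  rewrite (affinityE L0 pE).
  rewrite cE -/w /weight.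
  rewrite (powR_ratio (Mpos w) (Npos x)) -/(A w) -/(B x).
  by move: (A w) (B x) => Aw Bx; ring.
have unifE x y : affinity alpha vx vy mu (@pred_unif R d alpha vx vy) x y =
    weight (C * c) v S mu (fun=> 1) (fun=> 1) x (ga *: x + (1 - ga) *: y).
  have pE : @pred_unif R d alpha vx vy x y = 1 * phi (vy / ga) (y - x).
    rewrite mul1r /pred_unif; congr phi.
    by rewrite /ga /gam -/be; field; rewrite !gt_eqF// addr_gt0// mulr_gt0.
  by rewrite (affinityE ltr01 pE) cE powR1 /weight; ring.
have mw (F G : 'rV[R]_d -> R) : continuous F -> continuous G ->
    measurable_fun setT (fun t : ms_sort (euclid R d) * ms_sort (euclid R d) =>
      weight (C * c) v S mu F G (toV t.1) (ga *: toV t.1 + (1 - ga) *: toV t.2)).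
  move=> cF cG; apply: weight_measurable => //; first exact: mrow_fst.
  by apply: mrowD; apply: mrowZ; [exact: mrow_fst|exact: mrow_snd].
rewrite !(riskE vx0 vy0 alpha1); last 2 first.
- by under eq_fun do rewrite unifE; exact: mw.
- by under eq_fun do rewrite bayesE; exact: mw.
(* The affinities are subtracted, so from here on the uniform one has to be the smaller. *)
apply: leeB; first exact: lexx.
have gd0 : 0 < (1 - ga) ^+ d by rewrite exprn_gt0.
have iE p (F G : 'rV[R]_d -> R) : continuous F -> continuous G -> (forall w, 0 <= F w) ->
    (forall x, 0 <= G x) -> (forall x y, affinity alpha vx vy mu p x y =
      weight (C * c) v S mu F G x (ga *: x + (1 - ga) *: y)) ->
    (((1 - ga) ^+ d)%:E *
      intV (fun x => intV (fun y => (affinity alpha vx vy mu p x y)%:E)) =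
    intV (fun w => intV (fun x => (weight (C * c) v S mu F G x w)%:E)))%E.
  move=> cF cG F0 G0 H.
  have H' : (fun x => intV (fun y => (affinity alpha vx vy mu p x y)%:E)) =
      fun x => intV (fun y => (weight (C * c) v S mu F G x (ga *: x + (1 - ga) *: y))%:E).
    by apply/funext => x; apply: (congr1 (@intV R d)); apply/funext => y; rewrite H.
  by rewrite H'; exact: intV_weight.
apply: (lee_EFin_pmul2l gd0 (iE _ _ _ c1 c1 p10 p10 unifE) (iE _ _ _ cA cB A0 B0 bayesE)).
apply: ge0_le_integral => //.
- by move=> t _; apply: integral_ge0 => u _; rewrite lee_fin weight_ge0.
- exact: measurable_intV_weight.
- exact: measurable_intV_weight.
move=> t _; set w := toV t.
have v0 : 0 < v by exact: mulr_gt0.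
have Cv0 : 0 < C * c * phi v (w - mu) := mulr_gt0 (mulr_gt0 C0 c0) (phi_gt0 _ v0).
have -> : intV (fun x => (weight (C * c) v S mu (fun=> 1) (fun=> 1) x w)%:E) =
    (C * c * phi v (w - mu))%:E.
  rewrite -(@intV_cphi R d _ S w (ltW Cv0) S0); congr intV; apply/funext => x.
  by rewrite /weight !mul1r mulrA.
have -> : intV (fun x => (weight (C * c) v S mu A B x w)%:E) =
    ((C * c * phi v (w - mu) * A w)%:E * intV (fun x => (B x * phi S (x - w))%:E))%E.
  rewrite /intV -ge0_integralZl//; last 3 first.
  - apply: (@measurable_toV_compE _ _ (fun x => B x * phi S (x - w))).
    by apply: mulf_continuous => //; exact: phiB_continuous.
  - by move=> u _; rewrite lee_fin mulr_ge0 ?phi_ge0.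
  - by rewrite lee_fin mulr_ge0// ltW.
  apply: eq_integral => u _; rewrite -EFinM; congr EFin; rewrite /weight; ring.
(* At fixed w the Bayes integral is the uniform one multiplied by A w and a Gaussian mean of B; A w
   cancels exactly the lower bound of [mass_ge]. *)
have AM : A w * M w `^ (- (q - 1)) = 1.
  by rewrite /A powRN divff// gt_eqF// powR_gt0.
apply: (@le_trans _ _ ((C * c * phi v (w - mu) * A w)%:E * (M w `^ (- (q - 1)))%:E)%E).
  by rewrite -EFinM -[X in (_ <= X%:E)%E]mulrA AM mulr1 lexx.
by apply: lee_wpmul2l; [rewrite lee_fin mulr_ge0// ltW|exact: mass_ge].
Qed.

End Mean.
End Main.

Theorem theorem3 (R : realType) (d : nat) (vx vy alpha : R)
    (prior : 'rV[R]_d -> R) :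
  (3 <= d)%N -> 0 < vx -> 0 < vy -> -1 < alpha < 1 ->
  (forall n : int, 1 / beta alpha != n%:~R) ->
  regular_prior prior (vx * gam alpha vx vy) ->
  (forall (u : 'rV[R]_d) (t : R), 0 <= t <= xi alpha vx vy ->
     lap (fun w : 'rV[R]_d =>
            (fine (EZ (fun z : 'rV[R]_d =>
               (margR prior (t *: z + w) (vx * gam alpha vx vy))
                 `^ kappa alpha)))
            `^ (cbeta alpha / kappa alpha)) u <= 0) ->
  forall mu : 'rV[R]_d,
    (risk alpha vx vy (pred_bayes prior alpha vx vy) mu
       <= risk alpha vx vy (@pred_unif R d alpha vx vy) mu)%E.
Proof.
move=> d3 vx0 vy0 alpha1 _ reg lap_le0 mu.
by apply: risk_bayes_le_unif => //; exact: leq_trans d3.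
Qed.
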